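(* Let $g$ be a polynomial of degree $d\in\mathbb{N}$ with $g'(x)\neq 0$ for all $x\in[-1,1]$, let $f:[-1,1]\to\mathbb{C}$ be independent of $\omega$, and let $\nu$ be an even positive integer with $\nu\ge d+1$. Then, for $\omega$ sufficiently large, the Levin--Clenshaw--Curtis approximation $$\mathcal{Q}^{L,[\nu]}_\omega[f]=\mathrm{e}^{\mathrm{i}\omega g(1)}\sum_{n=0}^{\nu+1}\alpha_n-\mathrm{e}^{\mathrm{i}\omega g(-1)}\sum_{n=0}^{\nu+1}(-1)^n\alpha_n$$ to the integral $I_\omega[f]=\int_{-1}^1 f(x)\mathrm{e}^{\mathrm{i}\omega g(x)}\,\mathrm{d}x$, where $\boldsymbol{\alpha}=(\alpha_0,\dots,\alpha_{\nu+1})^\top\in\mathbb{C}^{\nu+2}$ is the solution of the collocation equations $$\sum_{n=0}^{\nu+1}\alpha_n\bigl(\mathrm{T}_n'(c_m)+\mathrm{i}\omega g'(c_m)\mathrm{T}_n(c_m)\bigr)=f(c_m),\qquad m=0,\dots,\nu+1,$$ can be computed using $\mathcal{O}(\nu\log\nu+d^2\nu)$ operations.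
   Context: $\mathrm{T}_n$ denotes the Chebyshev polynomial of the first kind of degree $n$. The Clenshaw--Curtis collocation points are $c_m=\cos\bigl(m\pi/(\nu+1)\bigr)$, $0\le m\le \nu+1$. ''Operations'' are arithmetic operations on complex numbers; the input consists of $\omega$, the coefficients of $g$ and the values $f(c_m)$. ''Sufficiently large $\omega$'' may depend on $g$ and $\nu$. *)

(* Defs.v *)
From mathcomp Require Import all_boot all_order all_algebra.
From mathcomp Require Import all_classical all_reals all_analysis.
From mathcomp Require Import complex.

Set Implicit Arguments.
Unset Strict Implicit.
Unset Printing Implicit Defensive.

Import Order.TTheory GRing.Theory Num.Theory.

Local Open Scope ring_scope.
Local Open Scope complex_scope.

(* e^(x + iy) = e^x (cos y + i sin y) *)
Definition cexp (R : realType) (z : R[i]) : R[i] :=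
  let: x +i* y := z in (expR x * cos y) +i* (expR x * sin y).

Fixpoint chebT (A : nzRingType) (n : nat) : {poly A} :=
  match n with
  | 0 => 1
  | 1 => 'X
  | (m.+1 as k).+1 => 'X *+ 2 * chebT A k - chebT A m
  end.

Definition cc_point (R : realType) (nu m : nat) : R :=
  cos (m%:R * pi / nu.+1%:R).

Definition levin_collocation (R : realType) (nu : nat) (g : {poly R[i]})
    (omega : R) (f : R -> R[i]) (alpha : 'cV[R[i]]_nu.+2) : Prop :=
  forall m : 'I_nu.+2,
    let c := cc_point R nu m in
    \sum_(n < nu.+2) alpha n 0 *
      ((chebT R[i] n)^`().[c%:C]
       + 'i * omega%:C * g^`().[c%:C] * (chebT R[i] n).[c%:C])
    = f c.

Definition levin_value (R : realType) (nu : nat) (g : {poly R[i]})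
    (omega : R) (alpha : 'cV[R[i]]_nu.+2) : R[i] :=
  cexp ('i * omega%:C * g.[1]) * \sum_(n < nu.+2) alpha n 0
  - cexp ('i * omega%:C * g.[-1]) * \sum_(n < nu.+2) (-1) ^+ n * alpha n 0.

(* Algorithms are algebraic computation trees over the complex numbers: a
   finite tree whose nodes act on a memory (a list of complex numbers) that
   initially holds the input. Every instruction appends its result to the
   memory, so addresses never change; operands are addresses. The only way in
   which control may depend on the data is the zero test (e.g. for pivoting).
   A tree is fixed before the input is known, so the constants it contains
   cannot depend on the input. *)
Inductive arith_op := Add | Sub | Mul | Div.

Inductive comp_tree (R : realType) :=
| Return of nat
| Const of R[i] & comp_tree R
| Arith of arith_op & nat & nat & comp_tree R
| Exp of nat & comp_tree R
| IfZero of nat & comp_tree R & comp_tree R.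

(* None is division by zero. *)
Definition arith (R : realType) (o : arith_op) (x y : R[i]) : option R[i] :=
  match o with
  | Add => Some (x + y)
  | Sub => Some (x - y)
  | Mul => Some (x * y)
  | Div => if y == 0 then None else Some (x / y)
  end.

(* Addresses outside the memory read as 0. *)
Fixpoint run (R : realType) (t : comp_tree R) (mem : seq R[i]) : option R[i] :=
  match t with
  | Return i => Some mem`_i
  | Const a t' => run t' (rcons mem a)
  | Arith o i j t' =>
      if arith o mem`_i mem`_j is Some z then run t' (rcons mem z) else None
  | Exp i t' => run t' (rcons mem (cexp mem`_i))
  | IfZero i t1 t2 => if mem`_i == 0 then run t1 mem else run t2 mem
  end.

(* Worst case over all branches; arithmetic operations, loading a constant,
   exponentials and zero tests all cost 1. *)
Fixpoint operations (R : realType) (t : comp_tree R) : nat :=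
  match t with
  | Return _ => 0
  | Const _ t' | Arith _ _ _ t' | Exp _ t' => (operations t').+1
  | IfZero _ t1 t2 => (maxn (operations t1) (operations t2)).+1
  end.

Fixpoint exponentials (R : realType) (t : comp_tree R) : nat :=
  match t with
  | Return _ => 0
  | Const _ t' | Arith _ _ _ t' => exponentials t'
  | Exp _ t' => (exponentials t').+1
  | IfZero _ t1 t2 => maxn (exponentials t1) (exponentials t2)
  end.

(* omega, then the coefficients of g in the monomial basis, by increasing
   degree, then the values of f at the collocation points. *)
Definition levin_input (R : realType) (nu : nat) (g : {poly R[i]})
    (omega : R) (f : R -> R[i]) : seq R[i] :=
  omega%:C :: polyseq g ++ [seq f (cc_point R nu m) | m <- iota 0 nu.+2].

(* Main.v *)
Require Import Defs.
From mathcomp Require Import all_boot all_order all_algebra.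
From mathcomp Require Import all_classical all_reals all_analysis.
From mathcomp Require Import complex zify ring lra.

Set Implicit Arguments.
Unset Strict Implicit.
Unset Printing Implicit Defensive.

Import Order.TTheory GRing.Theory Num.Theory.

Local Open Scope ring_scope.
Local Open Scope complex_scope.

(** Let L p = p' + i omega g' p (levin_op), and let N = nu + 1.  Collocation
    asks for p in the span of T_0, ..., T_N such that L p takes the values of f
    at the N + 1 nodes c_m, and the approximation needs only p(1) and p(-1).

    Put h = d - 1 = deg g', let F interpolate f at the nodes, and let w be the
    monic polynomial with the nodes as roots.  As L p has degree at most N + h,
    the collocation equations say that L p = F - w q for some q of degree less
    than h.  This turns a dense system of order nu into cheap pieces.

    - The Chebyshev coefficients of F come from a discrete Fourier transform of
      the even sequence f (cos (m pi / N)), 0 <= m < 2 N (cheb_interpolation).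
      Since 2 N is rarely a power of two, the transform is a chirp transform:
      j k = binomial (j + k, 2) - binomial (j, 2) - binomial (k, 2) makes it a
      Hankel product, and a Hankel matrix of order at most 2 ^ l is a block of
      (transform) * (diagonal) * (transform) of length 2 ^ (l + 1).  This costs
      O(nu log nu) operations (computes_dft).

    - In the basis U_i of Chebyshev polynomials of the second kind, T_k' is a
      multiple of U_(k-1) and multiplication by x is tridiagonal, so L T_k has
      O(d) coordinates, the highest of which is nonzero because deg g' = h and
      omega <> 0.  Division by L, that is P = L p + (remainder of degree < h),
      is therefore a back substitution in which no pivot can vanish, at a cost
      of O(d nu) (computes_division).

    - Dividing F and the h polynomials w x^j costs O(d^2 nu).  By linearity,
      q = sum z_j x^j is the right choice exactly when the remainder of
      F - w q vanishes, a dense h x h system.  It is nonsingular as soon as the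
      collocation equations have only the trivial homogeneous solution: if the
      remainder of w q vanishes then w q = L p, so L p vanishes at the nodes,
      hence p = 0 and q = 0 (remainder_nonsingular).  Its leading minors may
      vanish, so it is solved by elimination with zero tests on the pivots, in
      O(d^3) operations (computes_solve).

    - The collocation matrix is A + omega B, where B is the product of the
      diagonal matrix of the i g'(c_m) and the invertible matrix of the
      T_k(c_m).  It is singular only if - omega is an eigenvalue of B^-1 A,
      which excludes all large omega (unisolvent_eventually).

    Programs are never written down.  A value that occurs in a computation is
    represented as a function of the input, and a bound on the number of
    operations that produce some such functions from others is a proposition
    (computes) closed under composition; the tree is extracted from it at the
    end (levin_program). *)

(** * Programs seen through the functions of the input that they compute *)

Section Programs.
Local Open Scope classical_set_scope.
Variables (R : realType) (I : Type).
Local Notation C := R[i].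
Implicit Types (S : set I) (K : seq (I -> C)) (X Y Z : set (I -> C)).

(** Equality is only required on S, because after a zero test a memory cell is
    meaningful only for the inputs that took this branch. *)
Definition stored S K (x : I -> C) :=
  exists2 i, (i < size K)%N & forall s, S s -> (nth (fun=> 0) K i) s = x s.

Definition solvable S K (c e : nat) (out : I -> C) :=
  exists t : comp_tree R,
    [/\ (operations t <= c)%N, (exponentials t <= e)%N &
      forall s, S s -> run t [seq k s | k <- K] = Some (out s)].

(** A family Y is computed from X when, whatever else the memory contains and
    whatever remains to be done, c operations reduce the task to one in which Y
    is stored as well.  The continuation form is what allows zero tests: the
    remaining work may be carried out by different programs on different subsets
    S'' of the inputs, in which the addresses of Y differ. *)
Record computes S (c : nat) X Y : Prop := Computes {
  resume : forall S' K c' e out, S' `<=` S -> X `<=` stored S' K ->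
    (forall S'' K', S'' `<=` S' -> stored S' K `<=` stored S'' K' ->
      Y `<=` stored S'' K' -> solvable S'' K' c' e out) ->
    solvable S' K (c + c') e out
}.

Definition upto (n : nat) (x : nat -> I -> C) : set (I -> C) :=
  [set x i | i in `I_n].

Lemma uptoP n x i : (i < n)%N -> upto n x (x i).
Proof. by move=> lt_in; exists i. Qed.

Lemma nth_stored S K i x : (forall s, S s -> (nth (fun=> 0) K i) s = x s) ->
  forall s, S s -> [seq k s | k <- K]`_i = x s.
Proof.
move=> Kix s Ss; case: (ltnP i (size K)) => [lt|ge].
  by rewrite (nth_map (fun=> 0)) // Kix.
by rewrite nth_default ?size_map // -Kix // nth_default.
Qed.

Lemma stored_nth S K x : stored S K x ->
  exists i, forall s, S s -> [seq k s | k <- K]`_i = x s.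
Proof. by case=> i _ Ki; exists i => s Ss; rewrite (nth_stored Ki). Qed.

Lemma storedS S S' K x : S' `<=` S -> stored S K x -> stored S' K x.
Proof. by move=> sS [i iK Ki]; exists i => // s /sS; apply: Ki. Qed.

Lemma stored_rcons S K x y : stored S K x -> stored S (rcons K y) x.
Proof.
case=> i iK Ki; exists i; first by rewrite size_rcons ltnS ltnW.
by move=> s Ss; rewrite nth_rcons iK Ki.
Qed.

Lemma stored_last S K x : stored S (rcons K x) x.
Proof.
by exists (size K); rewrite ?size_rcons // => s _; rewrite nth_rcons ltnn eqxx.
Qed.

Lemma solvable_return S K out c e : stored S K out -> solvable S K c e out.
Proof.
case/stored_nth => i Ki; exists (Return R i); split=> // s Ss /=.
by rewrite Ki.
Qed.

Lemma solvable_exp S K x c e out : stored S K x ->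
  solvable S (rcons K (fun s => cexp (x s))) c e out ->
  solvable S K c.+1 e.+1 out.
Proof.
case/stored_nth => i Ki [t [tc te tout]]; exists (Exp i t); split=> // s Ss /=.
by rewrite -tout // map_rcons Ki.
Qed.

Lemma computes_trans S X Y Z c1 c2 :
  computes S c1 X Y -> computes S c2 (X `|` Y) Z ->
  computes S (c1 + c2) X (Y `|` Z).
Proof.
move=> XY YZ; split=> S' K c' e out sS XK cont; rewrite -addnA.
apply: (resume XY) => // S1 K1 sS1 KK1 YK1; apply: (resume YZ).
- exact: subset_trans sS.
- by move=> x [/XK/KK1|/YK1].
move=> S2 K2 sS2 K12 ZK2; apply: cont.
- exact: subset_trans sS1.
- by move=> x /KK1/K12.
by move=> x [/YK1/K12|/ZK2].
Qed.

(** Besides monotonicity, this replaces computed functions by functions that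
    agree with them on S: program steps produce definite expressions, whereas
    specifications need them only for admissible inputs. *)
Lemma computesW S S0 X X0 Y Y0 c c0 : computes S0 c0 X0 Y0 ->
  (c0 <= c)%N -> S `<=` S0 -> X0 `<=` X ->
  (forall y, Y y -> exists2 y0, (X `|` Y0) y0 & forall s, S s -> y0 s = y s) ->
  computes S c X Y.
Proof.
move=> XY le_c sS sX sY; split=> S' K c' e out sS' XK cont.
have [t [tc te tout]] : solvable S' K (c0 + c') e out; last first.
  by exists t; split=> //; apply: leq_trans tc _; rewrite leq_add2r.
apply: (resume XY).
- exact: subset_trans sS.
- by move=> x /sX/XK.
move=> S2 K2 sS2 KK2 YK2; apply: cont => // y /sY[y0 y0P y0E].
have [i iK Ki] : stored S2 K2 y0 by case: y0P => [/XK/KK2|/YK2].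
by exists i => // s Ss; rewrite Ki // y0E //; apply/sS'/sS2.
Qed.

Lemma computes_sub S X X0 Y Y0 c c0 : computes S c0 X0 Y0 ->
  (c0 <= c)%N -> X0 `<=` X -> Y `<=` X `|` Y0 -> computes S c X Y.
Proof.
by move=> XY lec sX sY; apply: computesW XY lec _ sX _ => // y /sY yP; exists y.
Qed.

Lemma computes0 S X : computes S 0 X X.
Proof. by split=> S' K c' e out sS XK cont; rewrite add0n; apply: cont. Qed.

Lemma computes_chain S X Y Z c1 c2 :
  computes S c1 X Y -> computes S c2 (X `|` Y) Z ->
  computes S (c1 + c2) X Z.
Proof.
move=> XY YZ; apply: computes_sub (computes_trans XY YZ) _ _ _ => //.
by move=> z Zz; right; right.
Qed.

Lemma computes_union S X Y Z c1 c2 :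
  computes S c1 X Y -> computes S c2 X Z -> computes S (c1 + c2) X (Y `|` Z).
Proof.
move=> XY XZ; apply: computes_trans XY _.
by apply: computes_sub XZ _ _ _.
Qed.

Lemma computes_bigcup S X (Y : nat -> set (I -> C)) n c :
  (forall i, (i < n)%N -> computes S c X (Y i)) ->
  computes S (n * c) X (\bigcup_(i in `I_n) Y i).
Proof.
elim: n => [_|n IHn XY].
  by apply: computes_sub (computes0 S X) _ _ _ => // z [].
have XYn := computes_union (IHn (fun i lt => XY i (ltnW lt))) (XY n (ltnSn n)).
apply: computes_sub XYn _ _ _ => //; first by rewrite mulSnr.
move=> z [i /=]; rewrite ltnS leq_eqVlt => /predU1P[->|lt_in] Yz.
  by right; right.
by right; left; exists i.
Qed.

Lemma computes_upto S X (y : nat -> I -> C) n c :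
  (forall i, (i < n)%N -> computes S c X [set y i]) ->
  computes S (n * c) X (upto n y).
Proof.
move=> XY; apply: computes_sub (computes_bigcup XY) _ _ _ => //.
by move=> z [i lt_in <-]; right; exists i.
Qed.

Lemma computes_const S X (a : C) : computes S 1 X [set fun=> a].
Proof.
split=> S' K c' e out sS XK cont.
have [t [tc te tout]] : solvable S' (rcons K (fun=> a)) c' e out.
  apply: cont => // [x|_ ->]; [exact: stored_rcons | exact: stored_last].
by exists (Const a t); split=> // s Ss /=; rewrite -tout // map_rcons.
Qed.

(** The hypothesis covers division too: it says that the operation is defined
    on all of S. *)
Lemma computes_arith S X x y (o : arith_op) (z : I -> C) :
  X x -> X y -> (forall s, S s -> arith o (x s) (y s) = Some (z s)) ->
  computes S 1 X [set z].
Proof.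
move=> Xx Xy oz; split=> S' K c' e out sS XK cont.
have [t [tc te tout]] : solvable S' (rcons K z) c' e out.
  apply: cont => // [u|_ ->]; [exact: stored_rcons | exact: stored_last].
have /stored_nth[i Ki] := XK _ Xx; have /stored_nth[j Kj] := XK _ Xy.
exists (Arith o i j t); split=> // s Ss /=.
by rewrite Ki // Kj // oz; [rewrite -tout // map_rcons | apply: sS].
Qed.

Lemma computes_add S X x y : X x -> X y ->
  computes S 1 X [set fun s => x s + y s].
Proof. by move=> Xx Xy; apply: (@computes_arith _ _ x y Add). Qed.

Lemma computes_subtract S X x y : X x -> X y ->
  computes S 1 X [set fun s => x s - y s].
Proof. by move=> Xx Xy; apply: (@computes_arith _ _ x y Defs.Sub). Qed.

Lemma computes_mul S X x y : X x -> X y ->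
  computes S 1 X [set fun s => x s * y s].
Proof. by move=> Xx Xy; apply: (@computes_arith _ _ x y Mul). Qed.

Lemma computes_div S X x y : X x -> X y -> (forall s, S s -> y s != 0) ->
  computes S 1 X [set fun s => x s / y s].
Proof.
move=> Xx Xy y0; apply: (@computes_arith _ _ x y Div) => // s /y0 /=.
by case: eqP.
Qed.

Lemma computes_ifzero S X Y c x : X x ->
  computes (S `&` [set s | x s = 0]) c X Y ->
  computes (S `&` [set s | x s != 0]) c X Y -> computes S c.+1 X Y.
Proof.
move=> Xx XY1 XY2; split=> S' K c' e out sS XK cont.
have branch P : computes (S `&` P) c X Y ->
    solvable (S' `&` P) K (c + c') e out.
  move=> XY; apply: (resume XY) => [|u /XK|]; first exact: setSI.
    by apply: storedS; apply: subIsetl.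
  move=> S2 K2 sS2 KK2 YK2; apply: cont => //.
    by apply: subset_trans sS2 _; apply: subIsetl.
  by move=> u uK; apply: KK2; apply: storedS uK; apply: subIsetl.
have [t1 [t1c t1e t1out]] := branch _ XY1.
have [t2 [t2c t2e t2out]] := branch _ XY2.
have /stored_nth[i Ki] := XK _ Xx.
exists (IfZero i t1 t2); split=> /= [||s Ss].
- by rewrite addSn ltnS geq_max t1c t2c.
- by rewrite geq_max t1e t2e.
rewrite Ki //; case: eqP => [x0|/eqP x0]; [exact: t1out | exact: t2out].
Qed.

Lemma computes_scale S X x (a : C) : X x ->
  computes S 2 X [set fun s => a * x s].
Proof.
move=> Xx; apply: (@computes_chain _ _ [set fun=> a] _ 1 1).
  exact: computes_const.
by apply: computes_mul; [right | left].
Qed.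

Lemma computes_sum S X n (x : nat -> I -> C) :
  upto n x `<=` X -> computes S n.+1 X [set fun s => \sum_(i < n) x i s].
Proof.
elim: n => [_|n IHn xX].
  apply: computesW (computes_const S X 0) _ _ _ _ => // y -> /=.
  by exists (fun=> 0); [right | move=> s _; rewrite big_ord0].
rewrite -addn1; apply: (computes_chain (IHn _)).
  by move=> _ [i lt_in <-]; apply/xX/uptoP/ltnW.
have lt := ltnSn n.
have := @computes_add S (X `|` [set fun s => \sum_(i < n) x i s]) _ (x n)
  (or_intror erefl) (or_introl (xX _ (uptoP x lt))).
move=> XY; apply: computesW XY _ _ _ _ => // _ ->.
exists (fun s => \sum_(i < n) x i s + x n s); first by right.
by move=> s _; rewrite big_ord_recr.
Qed.

Lemma computes_dot S X n (x y : nat -> I -> C) :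
  upto n x `<=` X -> upto n y `<=` X ->
  computes S (2 * n).+1 X [set fun s => \sum_(i < n) x i s * y i s].
Proof.
move=> xX yX; have -> : ((2 * n).+1 = n * 1 + n.+1)%N by lia.
apply: (@computes_chain _ _ (upto n (fun i s => x i s * y i s))).
  apply: computes_upto => i lt_in.
  exact: computes_mul (xX _ (uptoP x lt_in)) (yX _ (uptoP y lt_in)).
by apply: (@computes_sum _ _ n (fun i s => x i s * y i s)) => z zP; right.
Qed.

Lemma computes_lincomb S X n (a : nat -> C) (x : nat -> I -> C) :
  upto n x `<=` X ->
  computes S (3 * n).+1 X [set fun s => \sum_(i < n) a i * x i s].
Proof.
move=> xX; have -> : ((3 * n).+1 = n * 2 + n.+1)%N by lia.
apply: (@computes_chain _ _ (upto n (fun i s => a i * x i s))).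
  by apply: computes_upto => i lt_in;
    exact: computes_scale (xX _ (uptoP x lt_in)).
by apply: (@computes_sum _ _ n (fun i s => a i * x i s)) => z zP; right.
Qed.

End Programs.

(** * Roots of unity and the discrete Fourier transform *)

Section RootsOfUnity.
Variable R : realType.
Local Notation C := R[i].

(** The primitive root exp (i pi / N) of order 2 N. *)
Definition zeta (N : nat) : C := cos (pi / N%:R) +i* sin (pi / N%:R).

Lemma zetaX N k :
  zeta N ^+ k = cos (k%:R * pi / N%:R) +i* sin (k%:R * pi / N%:R).
Proof.
elim: k => [|k IHk]; first by rewrite expr0 !mul0r cos0 sin0.
have -> : k.+1%:R * pi / N%:R = k%:R * pi / N%:R + pi / N%:R :> R.
  by rewrite -natr1 mulrDl mul1r mulrDl.
by rewrite exprSr IHk cosD sinD; apply/eqP; rewrite eq_complex /=; apply/andP;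
  split; apply/eqP; ring.
Qed.

Lemma zeta_period N : (0 < N)%N -> zeta N ^+ (2 * N) = 1.
Proof.
move=> N0; rewrite zetaX.
have -> : (2 * N)%:R * pi / N%:R = pi *+ 2 :> R.
  by rewrite natrM -mulr_natr; field; rewrite pnatr_eq0 gtn_eqF.
by rewrite cos2pi sin2pi.
Qed.

Lemma zeta_neq0 N : (0 < N)%N -> zeta N != 0.
Proof.
move=> N0; apply/eqP => z0; have := zeta_period N0.
by rewrite z0 expr0n gtn_eqF ?muln_gt0 // => /esym/eqP; rewrite oner_eq0.
Qed.

Lemma zetaX_neq1 N k : (0 < k)%N -> (k < 2 * N)%N -> zeta N ^+ k != 1.
Proof.
move=> k0 ltk; rewrite zetaX; apply/eqP => -[cos1 _].
have N0 : 0 < N%:R :> R by rewrite ltr0n; lia.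
set t := k%:R * pi / N%:R / 2 : R.
have t0 : 0 < t by rewrite /t !divr_gt0 // mulr_gt0 ?pi_gt0 ?ltr0n.
have tpi : t < pi.
  rewrite /t ltr_pdivrMr // ltr_pdivrMr // mulrC.
  rewrite -mulrA ltr_pM2l ?pi_gt0 // -natrM ltr_nat; lia.
have sin_gt0 : 0 < sin t by apply: sin_gt0_pi; rewrite t0.
have : cos (t *+ 2) = 1 by rewrite -mulr_natr /t divfK ?pnatr_eq0.
rewrite mulr2n cosD -!expr2 cos2sin2 => /eqP.
rewrite -subr_eq0 (_ : _ - _ = - (sin t ^+ 2 *+ 2)); last by ring.
by rewrite oppr_eq0 mulrn_eq0 expf_eq0 /= gt_eqF.
Qed.

(** A geometric sum whose ratio is a 2 N-th root of unity other than 1. *)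
Lemma zeta_orthogonal N j m : (j < 2 * N)%N -> (m < 2 * N)%N ->
  \sum_(k < 2 * N) zeta N ^+ (j * k) / zeta N ^+ (m * k) =
    if j == m then (2 * N)%:R else 0.
Proof.
move=> ltj ltm; have N0 : (0 < N)%N by lia.
have z0 := zeta_neq0 N0.
set w := zeta N ^+ j / zeta N ^+ m.
rewrite (eq_bigr (fun k : 'I__ => w ^+ k)) => [|k _]; last first.
  by rewrite expr_div_n -!exprM.
case: eqP => [jm|/eqP jm].
  rewrite (eq_bigr (fun=> 1)) => [|k _]; first by rewrite sumr_const card_ord.
  by rewrite /w jm divff ?expr1n // expf_neq0.
have w1 : w - 1 != 0.
  have diff a b : (a < b)%N -> (b < 2 * N)%N -> zeta N ^+ a != zeta N ^+ b.
    move=> ltab ltb; rewrite -(subnKC (ltnW ltab)) exprD -subr_eq0.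
    rewrite -{1}[_ ^+ a]mulr1 -mulrBr mulf_neq0 ?expf_neq0 //.
    by rewrite subr_eq0 eq_sym zetaX_neq1 //; lia.
  have zm0 : zeta N ^+ m != 0 by rewrite expf_neq0.
  rewrite subr_eq0; apply: contra_neq (_ : zeta N ^+ j != zeta N ^+ m).
    by move=> wE; rewrite -[LHS](divfK zm0) -/w wE mul1r.
  by move: jm; rewrite neq_ltn => /orP[] lt; [|rewrite eq_sym]; apply: diff.
apply: (mulfI w1); rewrite mulr0 -subrX1 /w expr_div_n -!exprM.
by rewrite ![(_ * (2 * N))%N]mulnC !(exprM _ (2 * N)%N) zeta_period // !expr1n
  divr1 subrr.
Qed.

(** Normalised so that the inverse transform is a plain evaluation on the powers
    of zeta (see dft_inversion). *)
Definition dft N (x : nat -> C) (k : nat) : C :=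
  (2 * N)%:R^-1 * \sum_(m < 2 * N) (zeta N)^-1 ^+ (m * k) * x m.

Lemma dft_inversion N (x : nat -> C) j : (j < 2 * N)%N ->
  \sum_(k < 2 * N) zeta N ^+ (j * k) * dft N x k = x j.
Proof.
move=> ltj; under eq_bigr => k _ do rewrite mulrCA mulr_sumr.
rewrite -mulr_sumr exchange_big /=.
rewrite (eq_bigr (fun m : 'I_(2 * N) =>
    if m == Ordinal ltj then x j * (2 * N)%:R else 0)) => [|m _].
  rewrite -big_mkcond big_pred1_eq mulrC mulfK // pnatr_eq0; lia.
rewrite (eq_bigr (fun k : 'I_(2 * N) =>
    x m * (zeta N ^+ (j * k) / zeta N ^+ (m * k)))) => [|k _]; last first.
  by rewrite exprVn; ring.
rewrite -mulr_sumr zeta_orthogonal // -val_eqE /= eq_sym.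
by case: eqP => [->|]; rewrite ?mulr0.
Qed.

End RootsOfUnity.


(** * Fast Fourier transforms of arbitrary length *)

Lemma sum_even_odd (V : nmodType) n (F : nat -> V) :
  \sum_(j < 2 * n) F j = \sum_(j < n) F (2 * j)%N + \sum_(j < n) F (2 * j).+1.
Proof.
elim: n => [|n IHn]; first by rewrite !big_ord0 addr0.
by rewrite mulnS !big_ord_recr /= -/(2 * n)%N IHn addrACA -addrA.
Qed.

Section FastTransforms.
Local Open Scope classical_set_scope.
Variables (R : realType) (I : Type).
Local Notation C := R[i].
Implicit Types (S : set I) (X Y Z : set (I -> C)) (x y : nat -> I -> C).

(** Radix two: the sums over even and over odd indices are transforms of half
    the length for theta ^ 2, periodic in k, and each output needs one constant,
    one multiplication and one addition. *)
Lemma computes_fft S X l (theta : C) x :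
  theta ^+ (2 ^ l) = 1 -> upto (2 ^ l) x `<=` X ->
  computes S (3 * l * 2 ^ l) X
    (upto (2 ^ l) (fun k s => \sum_(j < 2 ^ l) theta ^+ (j * k) * x j s)).
Proof.
elim: l theta x => [|l IHl] theta x theta1 xX.
  apply: computesW (computes0 S X) _ _ _ _ => // _ [k ltk <-].
  exists (x 0%N); first by left; apply/xX/uptoP.
  by move=> s _; rewrite big_ord_recl big_ord0 mul0n expr0 mul1r addr0.
pose half e k s :=
  \sum_(j < 2 ^ l) (theta ^+ 2) ^+ (j * k) * x (2 * j + e)%N s.
have theta2 : (theta ^+ 2) ^+ (2 ^ l) = 1 by rewrite -exprM -expnS.
have halfP e : (e < 2)%N ->
    computes S (3 * l * 2 ^ l) X (upto (2 ^ l) (half e)).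
  move=> lte; apply: (IHl _ (fun j => x (2 * j + e)%N)) => // _ [j ltj <-].
  by apply/xX/uptoP; rewrite expnS; move: ltj => /=; lia.
have half_mod e k s : half e (k %% 2 ^ l)%N s = half e k s.
  apply: eq_bigr => j _; congr (_ * _); rewrite {2}(divn_eq k (2 ^ l)).
  rewrite mulnDr exprD mulnA (mulnC _ (2 ^ l)%N).
  by rewrite [_ ^+ (2 ^ l * _)]exprM theta2 expr1n mul1r.
have -> : (3 * l.+1 * 2 ^ l.+1 =
    3 * l * 2 ^ l + 3 * l * 2 ^ l + 2 ^ l.+1 * 3)%N.
  by rewrite expnS; lia.
apply: (computes_chain (computes_union (halfP 0%N isT) (halfP 1%N isT))).
apply: computes_upto => k ltk; set Y := X `|` _.
have inY e : (e < 2)%N -> Y (half e (k %% 2 ^ l)%N).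
  move=> lte; right; have lt : (k %% 2 ^ l < 2 ^ l)%N.
    by rewrite ltn_mod expn_gt0.
  by case: e lte => [|[|//]] _; [left | right]; apply: uptoP.
have scaled := computes_scale S (theta ^+ k) (inY 1%N isT).
have := computes_add S (or_introl (inY 0%N isT) :
  (Y `|` [set fun s => theta ^+ k * half 1%N (k %% 2 ^ l)%N s]) _)
  (or_intror erefl).
move/(computes_chain scaled) => sumP.
apply: computesW sumP _ _ _ _ => // _ ->.
exists (fun s => half 0%N (k %% 2 ^ l)%N s +
    theta ^+ k * half 1%N (k %% 2 ^ l)%N s); first by right.
move=> s _; rewrite !half_mod expnS.
rewrite (sum_even_odd _ (fun j => theta ^+ (j * k) * x j s)).
congr (_ + _); first by apply: eq_bigr => j _; rewrite addn0 -exprM mulnA.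
rewrite mulr_sumr; apply: eq_bigr => j _.
by rewrite addn1 mulSn exprD -exprM !mulrA mulnA.
Qed.

Lemma bin2D n m : ('C(n + m, 2) = 'C(n, 2) + 'C(m, 2) + n * m)%N.
Proof.
elim: n => [|n IHn]; first by rewrite mul0n addn0.
by rewrite addSn !binS IHn !bin1; lia.
Qed.

(** Bluestein's factorisation of the transform into two diagonal matrices and a
    Hankel matrix; binomials instead of halved squares avoid a square root of
    v. *)
Lemma chirp_factor (v : C) n m : v != 0 ->
  v ^+ (m * n) = v ^- 'C(n, 2) * (v ^+ 'C(n + m, 2) * v ^- 'C(m, 2)).
Proof.
move=> v0; rewrite bin2D !exprD mulnC mulrC.
by field; rewrite !expf_neq0.
Qed.

(** The entries H (n + m) of the Hankel matrix, extended to all indices below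
    2 ^ (l + 1), are a transform of some sequence h by inversion, whence
    sum_m H (n + m) a m = sum_r theta^(n r) h r (sum_m theta^(m r) a m).  Both
    sums over a power of two are fast, and h consists of constants. *)
Lemma computes_chirp S X P l (v : C) x :
  v != 0 -> (2 * P <= 2 ^ l.+1)%N -> upto P x `<=` X ->
  computes S (6 * l.+1 * 2 ^ l.+1 + 2 * 2 ^ l.+1 + 4 * P + 1) X
    (upto P (fun n s => \sum_(m < P) v ^+ (m * n) * x m s)).
Proof.
move=> v0 leP xX; set L := (2 ^ l.+1)%N.
have LE : L = (2 * 2 ^ l)%N by rewrite /L expnS.
pose theta : C := zeta R (2 ^ l).
have theta1 : theta ^+ L = 1 by rewrite LE zeta_period // expn_gt0.
pose h := dft (2 ^ l) (fun k => v ^+ 'C(k, 2)).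
pose a m s := if (m < P)%N then v ^- 'C(m, 2) * x m s else 0.
pose A r s := \sum_(m < L) theta ^+ (m * r) * a m s.
pose B r s := h r * A r s.
pose z n s := \sum_(r < L) theta ^+ (r * n) * B r s.
have -> : (6 * l.+1 * L + 2 * L + 4 * P + 1 =
  (P * 2 + 1) + (3 * l.+1 * L + (L * 2 + (3 * l.+1 * L + P * 2))))%N by lia.
apply: (@computes_chain _ _ _ _ (upto L a)).
  (* The zero constant pads the sequence to length L. *)
  have aP : computes S (P * 2 + 1) X (upto P a `|` [set fun=> 0]).
    apply: computes_union (computes_const S X 0).
    apply: computes_upto => m ltm.
    have xm := computes_scale S (v ^- 'C(m, 2)) (xX _ (uptoP x ltm)).
    apply: computesW xm _ _ _ _ => // _ ->.
    exists (fun s => v ^- 'C(m, 2) * x m s); first by right.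
    by move=> s _; rewrite /a ltm.
  apply: computesW aP _ _ _ _ => // _ [m ltm <-].
  case: (ltnP m P) => [ltmP|leP'].
    by exists (a m) => //; right; left; apply: uptoP.
  exists (fun=> 0); first by right; right.
  by move=> s _; rewrite /a ltnNge leP'.
apply: (@computes_chain _ _ _ _ (upto L A)).
  by apply: computes_fft => // u uP; right.
apply: (@computes_chain _ _ _ _ (upto L B)).
  apply: computes_upto => r ltr.
  by apply: computes_scale; right; apply: uptoP.
apply: (@computes_chain _ _ _ _ (upto L z)).
  by apply: computes_fft => // u uP; right.
apply: computes_upto => n ltn.
have nL : (n < L)%N by lia.
have zn := computes_scale S (v ^- 'C(n, 2)) (or_intror (uptoP z nL) :
  (X `|` upto L a `|` upto L A `|` upto L B `|` upto L z) (z n)).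
apply: computesW zn _ _ _ _ => // _ ->.
exists (fun s => v ^- 'C(n, 2) * z n s); first by right.
move=> s _; have -> : z n s = \sum_(m < L) v ^+ 'C(n + m, 2) * a m s.
  rewrite /z /B /A.
  under eq_bigr => r _ do rewrite mulrA mulr_sumr.
  rewrite exchange_big /=; apply: eq_bigr => m _.
  case: (ltnP m P) => ltmP; last first.
    by rewrite /a ltnNge ltmP mulr0 big1 // => r _; rewrite !mulr0.
  have lt : (n + m < 2 * 2 ^ l)%N by lia.
  rewrite -(dft_inversion (fun k => v ^+ 'C(k, 2)) lt) -/h -LE mulr_suml.
  apply: eq_bigr => r _; rewrite -/theta mulnDl exprD [(n * r)%N]mulnC.
  ring.
have leL : (P <= L)%N by lia.
rewrite (big_ord_widen _ (fun m => v ^+ (m * n) * x m s) leL).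
rewrite [in RHS]big_mkcond.
rewrite mulr_sumr; apply: eq_bigr => m _ /=; rewrite /a.
by case: ifP; rewrite ?mulr0 // (chirp_factor _ _ v0) !mulrA.
Qed.

Lemma computes_dft S X N l x :
  (0 < N)%N -> (4 * N <= 2 ^ l.+1)%N -> upto (2 * N) x `<=` X ->
  computes S (6 * l.+1 * 2 ^ l.+1 + 2 * 2 ^ l.+1 + 12 * N + 1) X
    (upto (2 * N) (fun k s => dft N (x ^~ s) k)).
Proof.
move=> N0 leN xX; have v0 : (zeta R N)^-1 != 0 by rewrite invr_eq0 zeta_neq0.
have leN' : (2 * (2 * N) <= 2 ^ l.+1)%N by lia.
have -> : (6 * l.+1 * 2 ^ l.+1 + 2 * 2 ^ l.+1 + 12 * N + 1 =
  (6 * l.+1 * 2 ^ l.+1 + 2 * 2 ^ l.+1 + 4 * (2 * N) + 1) + (2 * N) * 2)%N.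
  by lia.
apply: (computes_chain (computes_chirp S v0 leN' xX)).
apply: computes_upto => k ltk; apply: computes_scale; right.
exact: (uptoP (fun n s => \sum_(m < 2 * N) _ ^+ (m * n) * x m s)).
Qed.

End FastTransforms.

(** * Banded and dense linear systems *)

Section LinearSystems.
Local Open Scope classical_set_scope.
Variables (R : realType) (I : Type).
Local Notation C := R[i].
Implicit Types (S : set I) (X Y Z : set (I -> C)) (x y : nat -> I -> C).

Lemma computes_submul S X (r a l : I -> C) : X r -> X a -> X l ->
  computes S 2 X [set fun s => r s - a s * l s].
Proof.
move=> Xr Xa Xl; apply: (computes_chain (computes_mul S Xa Xl) (c2 := 1)).
exact: computes_subtract (or_introl Xr) (or_intror erefl).
Qed.

(** The rows k - b, ..., k + h of column k, without truncated subtraction. *)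
Definition in_band (b h k i : nat) := (k <= i + b)%N && (i <= k + h)%N.

(** Columns are eliminated from the last to the first, each clearing one entry
    of the right-hand side: column k reaches down exactly to row k + h, so row
    k + h is not touched again.  Rows below h are left as a remainder. *)
Lemma computes_back_substitution S X h b n (l : nat -> nat -> I -> C)
    (r : nat -> I -> C) :
  (forall k i, (k < n)%N -> in_band b h k i -> X (l k i)) ->
  (forall s k i, S s -> (k < n)%N -> ~~ in_band b h k i -> l k i s = 0) ->
  (forall s k, S s -> (k < n)%N -> l k (k + h)%N s != 0) ->
  upto (n + h) r `<=` X ->
  exists a rem : nat -> I -> C,
    (forall s i, S s -> (i < n + h)%N ->
      r i s = \sum_(k < n) a k s * l k i s + (if (i < h)%N then rem i s else 0))
    /\ computes S (n * (2 * (b + h) + 1)) X (upto n a `|` upto h rem).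
Proof.
elim: n X r => [|n IHn] X r Xl l0 piv Xr.
  exists (fun _ _ => 0), r; split=> [s i _ lti|].
    by rewrite big_ord0 add0r lti.
  by apply: computes_sub (computes0 S X) _ _ _ => // u [[k //]|/Xr Xu]; left.
pose an s := r (n + h)%N s / l n (n + h)%N s.
pose r' i s := if (n <= i + b)%N then r i s - an s * l n i s else r i s.
pose X' := X `|` ([set an] `|` upto (n + h) r').
have step : computes S (1 + 2 * (b + h)) X ([set an] `|` upto (n + h) r').
  apply: computes_trans.
    apply: computes_div; first by apply: Xr; apply: uptoP; lia.
      by apply: Xl; rewrite /in_band; lia.
    by move=> s Ss; apply: piv.
  have : computes S ((n + h - (n - b)) * 2) (X `|` [set an])
      (upto (n + h - (n - b)) (fun j s =>
        r (n - b + j)%N s - an s * l n (n - b + j)%N s)).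
    apply: computes_upto => j ltj; apply: computes_submul.
    - by left; apply: Xr; apply: uptoP; lia.
    - by right.
    by left; apply: Xl; rewrite /in_band; lia.
  move=> comp; apply: computesW comp _ _ _ _ => //; first by lia.
  move=> _ [i /= lti <-]; rewrite /r'; case: leqP => leb; last first.
    by exists (r i) => //; left; left; apply: Xr; apply: uptoP; lia.
  exists (fun s => r i s - an s * l n i s) => //; right.
  by exists (i - (n - b))%N => /=; [lia | rewrite subnKC //; lia].
have [||||a [rem [E comp]]] := IHn X' r'.
- by move=> k i ltk bk; left; apply: Xl => //; apply: ltnW.
- by move=> s k i Ss ltk; apply: l0 => //; apply: ltnW.
- by move=> s k Ss ltk; apply: piv => //; apply: ltnW.
- by move=> u uP; right; right.
exists (fun k s => if k == n then an s else a k s), rem; split; last first.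
  apply: computesW (computes_trans step comp) _ _ _ _ => //; first by lia.
  move=> u [[k ltk <-]|uP]; last by exists u => //; right; right; right.
  have [kn|kn] := eqVneq k n.
    by exists an => //; right; left; left.
  exists (a k) => //; right; right; left; apply: uptoP.
  by rewrite ltn_neqAle kn -ltnS.
move=> s i Ss lti.
rewrite big_ord_recr /= eqxx (eq_bigr (fun k : 'I_n => a k s * l k i s)).
  2: by move=> k _; rewrite ltn_eqF.
have [ltin|lein] := ltnP i (n + h)%N.
  rewrite addrAC -E //= /r'; case: leqP => leb; first by rewrite subrK.
  by rewrite [l n i s]l0 ?mulr0 ?addr0 // /in_band; lia.
have -> : i = (n + h)%N by lia.
rewrite big1 ?add0r => [|k _]; last first.
  by rewrite l0 ?mulr0 // /in_band; have := ltn_ord k; lia.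
by rewrite /an divfK ?piv // ltnNge leq_addl addr0.
Qed.

(** Any tree is correct when no input is left. *)
Lemma computes_empty X Y c : computes (set0 : set I) c X Y.
Proof.
split=> S' K c' e out sS _ _.
by exists (Return R 0); split=> // s /sS.
Qed.

(** Zero tests find a pivot: every continuation may assume that one particular
    x p is nonzero, and the case in which all are zero has no input. *)
Lemma computes_search S X Y n c x :
  upto n x `<=` X -> (forall s, S s -> exists2 p, (p < n)%N & x p s != 0) ->
  (forall p, (p < n)%N ->
    computes (S `&` [set s | x p s != 0]) c X Y) ->
  computes S (n + c) X Y.
Proof.
elim: n S => [|n IHn] S xX xn0 comp.
  have -> : S = set0 by rewrite -subset0 => s /xn0[].
  exact: computes_empty.
rewrite addSn; apply: computes_ifzero (xX _ (uptoP x (ltnSn n))) _ _.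
  apply: IHn => [|s [Ss /= x0]|p ltp].
  - by move=> _ [p ltp <-]; apply/xX/uptoP/ltnW.
  - have [p ltp xp] := xn0 _ Ss; exists p => //.
    rewrite ltn_neqAle -ltnS ltp andbT.
    by apply: contra_neq xp => ->.
  apply: computesW (comp p (ltnW ltp)) _ _ _ _ => //.
    by move=> s [[]].
  by move=> y Yy; exists y => //; right.
apply: computesW (comp n (ltnSn n)) _ _ _ _ => //; first exact: leq_addl.
by move=> y Yy; exists y => //; right.
Qed.

(** Indices are natural numbers, so that deleting a pivot row is a mere
    renumbering by bump. *)
Definition nonsingular n (b : nat -> nat -> C) := forall y : nat -> C,
  (forall i, (i < n)%N -> \sum_(j < n) b i j * y j = 0) ->
  forall j, (j < n)%N -> y j = 0.

Lemma nonsingular_col0 n b : nonsingular n.+1 b ->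
  exists2 p, (p < n.+1)%N & b p 0%N != 0.
Proof.
move=> nsb; apply: contrapT => nex.
have /(_ _ 0%N isT)/eqP := nsb (fun j => if j == 0%N then 1 else 0).
rewrite oner_eq0 => absurd; suff : false by []; apply: absurd => i lti.
rewrite big_ord_recl big1 ?addr0 /= ?mulr1 => [|j _]; last by rewrite mulr0.
by apply/eqP/negPn/negP => bi; apply: nex; exists i.
Qed.

(** One elimination step with pivot row p in column 0. *)
Definition schur (p : nat) (b : nat -> nat -> C) i j : C :=
  b (bump p i) j.+1 - b (bump p i) 0%N / b p 0%N * b p j.+1.

Lemma bump_lt p i n : (i < n)%N -> (bump p i < n.+1)%N.
Proof. by rewrite /bump; case: (p <= i)%N; lia. Qed.

Lemma bump_cover p i n : (p < n.+1)%N -> (i < n.+1)%N -> i = p \/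
  exists2 j, (j < n)%N & i = bump p j.
Proof.
move=> ltp lti; have [->|ip] := eqVneq i p; [by left | right].
exists (unbump p i); last by rewrite unbumpKcond (negPf ip).
by rewrite /unbump; case: (ltnP p i); lia.
Qed.

Lemma sum_row_sub n (u v y : nat -> C) (q : C) :
  \sum_(j < n) (u j - q * v j) * y j =
    \sum_(j < n) u j * y j - q * \sum_(j < n) v j * y j.
Proof.
by rewrite mulr_sumr -sumrB; apply: eq_bigr => j _; rewrite mulrBl mulrA.
Qed.

(** A kernel vector of the reduced matrix extends to one of b: its entry 0 is
    chosen so as to satisfy row p. *)
Lemma nonsingular_schur n p b : (p < n.+1)%N -> b p 0%N != 0 ->
  nonsingular n.+1 b -> nonsingular n (schur p b).
Proof.
move=> ltp bp nsb y y0 j ltj.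
(* The value of the eliminated unknown forced by row p. *)
pose y1 := - (\sum_(j < n) b p j.+1 * y j) / b p 0%N.
apply: (nsb (fun j => if j is j'.+1 then y j' else y1) _ j.+1 ltj) => i lti.
rewrite big_ord_recl /=.
have [->|[k ltk ->]] := bump_cover ltp lti.
  by rewrite /y1 mulrC divfK // addrC subrr.
rewrite -[RHS](y0 k ltk) /schur /y1.
rewrite (sum_row_sub _ (fun j => b (bump p k) j.+1) (fun j => b p j.+1)).
by rewrite addrC; congr (_ + _); ring.
Qed.

(** The pivot row p depends on the branch of the search, but the solution z does
    not, so the branches meet the same specification. *)
Lemma computes_solve S X n (b : nat -> nat -> I -> C) (c z : nat -> I -> C) :
  (forall i j, (i < n)%N -> (j < n)%N -> X (b i j)) ->
  upto n c `<=` X ->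
  (forall s, S s -> nonsingular n (fun i j => b i j s)) ->
  (forall s i, S s -> (i < n)%N -> \sum_(j < n) b i j s * z j s = c i s) ->
  computes S (4 * n ^ 3) X (upto n z).
Proof.
elim: n S X b c z => [|n IHn] S X b c z Xb Xc nsb bz.
  by apply: computes_sub (computes0 S X) _ _ _ => // u [].
have cost : (n.+1 + (n * (1 + n * 2 + 2) + (4 * n ^ 3 + (2 * n + 3))) <=
    4 * n.+1 ^ 3)%N by rewrite !expnS expn0; nia.
suff comp : computes S
    (n.+1 + (n * (1 + n * 2 + 2) + (4 * n ^ 3 + (2 * n + 3)))) X (upto n.+1 z).
  by apply: computes_sub comp cost _ _.
apply: (@computes_search _ _ _ _ _ (fun i => b i 0%N)) => [|s /nsb|p ltp].
- by move=> _ [i lti <-]; apply: Xb.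
- exact: nonsingular_col0.
set S' := S `&` _.
pose f i s := b (bump p i) 0%N s / b p 0%N s.
pose b' i j s := schur p (fun i j => b i j s) i j.
pose c' i s := c (bump p i) s - f i s * c p s.
pose row i := upto n (b' i) `|` [set c' i].
apply: (@computes_chain _ _ _ _ (\bigcup_(i in `I_n) row i)).
  apply: computes_bigcup => i lti; have ltb := bump_lt p lti.
  apply: (@computes_chain _ _ _ _ [set f i] _ 1 (n * 2 + 2)).
    by apply: computes_div; [exact: Xb | exact: Xb | move=> s []].
  apply: computes_union; last first.
    by apply: computes_submul; [left; apply/Xc/uptoP | right |
      left; apply/Xc/uptoP].
  apply: computes_upto => j ltj.
  by apply: computes_submul; [left; apply: Xb | right | left; apply: Xb].
have bz' s i : S' s -> (i < n)%N -> \sum_(j < n) b' i j s * z j.+1 s = c' i s.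
  move=> [Ss /= bp] lti; rewrite /c' -(bz s (bump p i)) ?bump_lt //.
  rewrite -(bz s p) // !big_ord_recl /= /f /b' /schur.
  rewrite (sum_row_sub _ (fun j => b (bump p i) j.+1 s)
    (fun j => b p j.+1 s) (fun j => z j.+1 s)).
  by field.
apply: (@computes_chain _ _ _ _ (upto n (fun j => z j.+1))).
  apply: (IHn _ _ b' c') => //.
  - move=> i j lti ltj; right; exists i => //; left; exact: uptoP.
  - by move=> _ [i lti <-]; right; exists i => //; right.
  by move=> s [Ss bp]; apply: nonsingular_schur => //; apply: nsb.
set Y := X `|` _ `|` _.
pose dot s := \sum_(j < n) b p j.+1 s * z j.+1 s.
have -> : (2 * n + 3 = (2 * n).+1 + (1 + 1))%N by lia.
have dotP : computes S' (2 * n).+1 Y [set dot].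
  apply: (@computes_dot _ _ _ _ n (fun j => b p j.+1) (fun j => z j.+1)).
    by move=> _ [j ltj <-]; left; left; apply: Xb.
  by move=> u uP; right.
have subP : computes S' 1 (Y `|` [set dot]) [set fun s => c p s - dot s].
  apply: computes_subtract; last by right.
  by left; left; left; apply/Xc/uptoP.
have divP : computes S' 1 (Y `|` [set dot] `|` [set fun s => c p s - dot s])
    [set fun s => (c p s - dot s) / b p 0%N s].
  apply: computes_div; first by right.
    by left; left; left; left; apply: Xb.
  by move=> s [].
have allP := computes_chain dotP (computes_chain subP divP).
apply: computesW allP _ _ _ _ => // _ [[|j] ltj <-].
  exists (fun s => (c p s - dot s) / b p 0%N s); first by right.
  move=> s [Ss /= bp]; rewrite -(bz s p) // big_ord_recl /= addrK.
  by rewrite mulrC mulKf.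
by exists (z j.+1) => //; left; right; apply: (uptoP (fun j => z j.+1)).
Qed.

End LinearSystems.

(** * Coordinates in a graded basis of polynomials *)

Section GradedBasis.
Variables (F : fieldType) (e : nat -> {poly F}).
Hypothesis size_e : forall n, size (e n) = n.+1.

(** The i-th coordinate in the basis e_0, ..., e_(n-1), found by clearing the
    leading coefficient repeatedly.  It is linear on all polynomials, and it is
    the coordinate when the degree is less than n (gcoordK). *)
Fixpoint gcoord (n : nat) (p : {poly F}) (i : nat) : F :=
  if n is m.+1 then
    let c := p`_m / (e m)`_m in
    if i == m then c else gcoord m (p - c *: e m) i
  else 0.

Lemma e_lead_neq0 n : (e n)`_n != 0.
Proof.
by rewrite -[n in _`_n]/(n.+1.-1) -size_e lead_coef_eq0 -size_poly_eq0 size_e.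
Qed.

Lemma gcoord_linear n i a p q :
  gcoord n (a *: p + q) i = a * gcoord n p i + gcoord n q i.
Proof.
elim: n p q => [|n IHn] p q /=; first by rewrite mulr0 addr0.
case: eqP => _; first by rewrite coefD coefZ mulrDl -mulrA.
rewrite -IHn; congr gcoord; rewrite coefD coefZ scalerBr scalerA.
by rewrite mulrDl scalerDl opprD mulrA addrACA.
Qed.

Lemma gcoord0 n i : gcoord n 0 i = 0.
Proof.
by have := gcoord_linear n i (-1) 0 0; rewrite scaler0 addr0 mulN1r addNr.
Qed.

Lemma gcoordD n i p q : gcoord n (p + q) i = gcoord n p i + gcoord n q i.
Proof. by have := gcoord_linear n i 1 p q; rewrite scale1r mul1r. Qed.

Lemma gcoordZ n i a p : gcoord n (a *: p) i = a * gcoord n p i.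
Proof. by have := gcoord_linear n i a p 0; rewrite gcoord0 !addr0. Qed.

Lemma gcoord_sum n i m (G : nat -> {poly F}) (a : nat -> F) :
  gcoord n (\sum_(k < m) a k *: G k) i = \sum_(k < m) a k * gcoord n (G k) i.
Proof.
elim: m => [|m IHm]; first by rewrite !big_ord0 gcoord0.
by rewrite !big_ord_recr /= gcoordD gcoordZ IHm.
Qed.

Lemma size_sub_top n (p : {poly F}) : (size p <= n.+1)%N ->
  (size (p - (p`_n / (e n)`_n) *: e n)%R <= n)%N.
Proof.
move=> le_p; apply/leq_sizeP => j; rewrite leq_eqVlt => /predU1P[<-|ltj].
  by rewrite coefB coefZ divfK ?e_lead_neq0 // subrr.
rewrite coefB coefZ [p`_j]nth_default ?[(e n)`_j]nth_default ?mulr0 ?subrr //.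
  by rewrite size_e.
exact: leq_trans ltj.
Qed.

Lemma gcoordK n (p : {poly F}) : (size p <= n)%N ->
  p = \sum_(i < n) gcoord n p i *: e i.
Proof.
elim: n p => [|n IHn] p le_p.
  by rewrite big_ord0; apply/eqP; rewrite -size_poly_leq0.
rewrite big_ord_recr /= eqxx.
rewrite (eq_bigr (fun i : 'I_n =>
    gcoord n (p - (p`_n / (e n)`_n) *: e n) i *: e i)) => [|i _]; last first.
  by rewrite ltn_eqF.
by rewrite -IHn ?subrK ?size_sub_top.
Qed.

Lemma gcoord_high n (p : {poly F}) i : (size p <= i)%N -> gcoord n p i = 0.
Proof.
elim: n p => [|n IHn] p le_p //=; case: eqP => [<-|/eqP ni].
  by rewrite nth_default ?mul0r.
have [lei|lti] := leqP i n; last first.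
  have : forall m q, (m <= i)%N -> gcoord m q i = 0.
    elim=> [//|m IHm] q ltm /=; rewrite gtn_eqF // IHm //; exact: ltnW.
  by apply; apply: ltnW.
have lt_in : (i < n)%N by rewrite ltn_neqAle ni.
rewrite [p`_n]nth_default ?mul0r ?scale0r ?subr0 ?IHn //.
exact: leq_trans le_p lei.
Qed.

Lemma gcoord_e n k i : (k < n)%N -> gcoord n (e k) i = (i == k)%:R.
Proof.
elim: n => [//|n IHn]; rewrite ltnS leq_eqVlt => /predU1P[->|ltk] /=.
  rewrite divff ?e_lead_neq0 //; case: eqP => // _.
  by rewrite scale1r subrr gcoord0.
case: (eqVneq i n) => [->|ni]; last first.
  by rewrite [(e k)`_n]nth_default ?size_e // mul0r scale0r subr0 IHn.
by rewrite nth_default ?size_e // mul0r gtn_eqF.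
Qed.

Lemma gcoord_lead n (p : {poly F}) m : (m < n)%N -> size p = m.+1 ->
  gcoord n p m != 0.
Proof.
move=> ltm sp; apply/eqP => c0.
have pE : p = \sum_(i < m) gcoord n p i *: e i.
  have le_pn : (size p <= n)%N by rewrite sp.
  rewrite {1}(gcoordK le_pn).
  rewrite (big_ord_widen _ (fun i => gcoord n p i *: e i) (ltnW ltm)).
  rewrite [in RHS]big_mkcond; apply: eq_bigr => i _ /=.
  case: ltngtP => // [lt|->]; last by rewrite c0 scale0r.
  by rewrite gcoord_high ?scale0r // sp.
have : (size p <= m)%N.
  rewrite pE; apply: leq_trans (size_sum _ _ _) _; apply/bigmax_leqP => i _.
  by apply: leq_trans (size_scale_leq _ _) _; rewrite size_e.
by rewrite sp ltnn.
Qed.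

End GradedBasis.

Arguments gcoord : simpl never.


(** * Chebyshev polynomials and interpolation at the Clenshaw--Curtis points *)

Section Chebyshev.
Variable R : realType.
Local Notation C := R[i].

(** Chebyshev polynomials of the second kind. *)
Fixpoint chebU (A : nzRingType) (n : nat) : {poly A} :=
  match n with
  | 0 => 1
  | 1 => 'X *+ 2
  | (m.+1 as k).+1 => 'X *+ 2 * chebU A k - chebU A m
  end.

Local Notation T := (chebT C).
Local Notation U := (chebU C).

Lemma pair_ind (P : nat -> Prop) :
  P 0%N -> P 1%N -> (forall n, P n -> P n.+1 -> P n.+2) -> forall n, P n.
Proof.
move=> P0 P1 PS n; suff [] : P n /\ P n.+1 by [].
by elim: n => // n [Pn Pn1]; split=> //; apply: PS.
Qed.

Lemma size_recurrence (a : nat -> {poly C}) : size (a 0%N) = 1%N ->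
  size (a 1%N) = 2%N -> (forall n, a n.+2 = 'X *+ 2 * a n.+1 - a n) ->
  forall n, size (a n) = n.+1.
Proof.
move=> s0 s1 rec; apply: pair_ind => // n sn sn1.
have sX : size ('X *+ 2 * a n.+1) = n.+3.
  rewrite mulrnAl -scaler_nat size_scale ?pnatr_eq0 //.
  by rewrite mulrC size_mulX ?sn1 // -size_poly_eq0 sn1.
by rewrite rec size_polyDl sX // size_polyN sn.
Qed.

Lemma size_chebT n : size (T n) = n.+1.
Proof. by apply: size_recurrence => //; rewrite ?size_poly1 ?size_polyX. Qed.

Lemma size_chebU n : size (U n) = n.+1.
Proof.
apply: size_recurrence => //=; first by rewrite size_poly1.
by rewrite -scaler_nat size_scale ?pnatr_eq0 // size_polyX.
Qed.

Lemma chebT_cos n (t : R) : (T n).[(cos t)%:C] = (cos (n%:R * t))%:C.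
Proof.
elim/pair_ind: n => [||n IHn IHn1] /=.
- by rewrite hornerC mul0r cos0.
- by rewrite hornerX mul1r.
rewrite hornerD hornerN hornerM hornerMn hornerX -/(T n.+1) IHn IHn1.
rewrite -rmorphMn -rmorphM -rmorphB; congr (_%:C).
have -> : n.+2%:R * t = n.+1%:R * t + t by rewrite -natr1; ring.
have -> : n%:R * t = n.+1%:R * t - t by rewrite -natr1; ring.
by rewrite !cosD cosN sinN; ring.
Qed.

Lemma double_chebT n : T n.+2 *+ 2 = U n.+2 - U n.
Proof.
elim/pair_ind: n => [||n IHn IHn1]; [by rewrite /=; ring|by rewrite /=; ring|].
rewrite [T n.+4](_ : _ = 'X *+ 2 * T n.+3 - T n.+2) //.
rewrite [U n.+4](_ : _ = 'X *+ 2 * U n.+3 - U n.+2) //.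
have U0 : U n = 'X *+ 2 * U n.+1 - U n.+2.
  by rewrite [U n.+2](_ : _ = 'X *+ 2 * U n.+1 - U n) // opprB addrC subrK.
rewrite mulrnBl IHn -mulrnAr IHn1 U0; ring.
Qed.

Lemma chebT_U n : T n.+2 = 2^-1 *: (U n.+2 - U n).
Proof.
have two : (2 : C) != 0 by rewrite pnatr_eq0.
by rewrite -double_chebT -[T _ *+ 2]scaler_nat scalerA mulVf // scale1r.
Qed.

Lemma mulX_chebU n : 'X * U n.+1 = 2^-1 *: (U n.+2 + U n).
Proof.
have two : (2 : C) != 0 by rewrite pnatr_eq0.
rewrite [U n.+2](_ : _ = 'X *+ 2 * U n.+1 - U n) // subrK mulrnAl.
by rewrite -[_ * _ *+ 2]scaler_nat scalerA mulVf // scale1r.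
Qed.

Lemma deriv_chebT n : (T n.+1)^`() = U n *+ n.+1.
Proof.
elim/pair_ind: n => [||n IHn IHn1].
- by rewrite derivX.
- by rewrite /= derivB derivM derivMn derivX derivC subr0; ring.
rewrite [T n.+3](_ : _ = 'X *+ 2 * T n.+2 - T n.+1) //.
rewrite derivB derivM derivMn derivX IHn1 IHn (mulrnAl 1) mul1r.
have T2 := double_chebT n.
have U2 : 'X *+ 2 * U n.+1 = U n.+2 + U n.
  by rewrite [U n.+2](_ : _ = 'X *+ 2 * U n.+1 - U n) // subrK.
rewrite T2 mulrnAr U2.
ring.
Qed.

Local Notation ucoord := (gcoord U).

Lemma ucoord_deriv M k i : (k <= M)%N -> i.+1 != k ->
  ucoord M (T k)^`() i = 0.
Proof.
case: k => [|k] lek ik; first by rewrite derivC gcoord0.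
rewrite deriv_chebT -scaler_nat gcoordZ (gcoord_e size_chebU) //.
by rewrite -eqSS (negPf ik) mulr0.
Qed.

(** T_0 = U_0, 2 T_1 = U_1 and 2 T_k = U_k - U_(k-2). *)
Lemma ucoord_chebT M k i : (k < M)%N -> i != k -> i.+2 != k ->
  ucoord M (T k) i = 0.
Proof.
have gcoordU := gcoord_e size_chebU.
case: k => [|[|k]] lek ik ik2.
- by rewrite (gcoordU _ 0%N) // (negPf ik).
- have -> : T 1 = 2^-1 *: U 1.
    by rewrite /= -['X *+ 2]scaler_nat scalerA mulVf ?scale1r // pnatr_eq0.
  by rewrite gcoordZ gcoordU // (negPf ik) mulr0.
rewrite chebT_U gcoordZ -scaleN1r gcoordD gcoordZ !gcoordU //; last by lia.
have -> : (i == k) = false by lia.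
by rewrite (negPf ik) mulr0 addr0 mulr0.
Qed.

(** Multiplication by x is tridiagonal in the U_i, so it lowers the least
    nonzero coordinate by at most one. *)
Lemma ucoord_mulX M (p : {poly C}) k b : (size p < M)%N ->
  (forall i, (i + b < k)%N -> ucoord M p i = 0) ->
  forall i, (i + b.+1 < k)%N -> ucoord M ('X * p) i = 0.
Proof.
move=> ltp p0 i lti; have gcoordU := gcoord_e size_chebU.
rewrite {1}(gcoordK size_chebU (ltnW ltp)) mulr_sumr.
under eq_bigr => m _ do rewrite -scalerAr.
rewrite (gcoord_sum _ _ _ _ (fun m => 'X * U m) (ucoord M p)).
apply: big1 => m _; have [ltm|lem] := ltnP (m + b)%N k.
  by rewrite p0 ?mul0r.
have [ltpm|lepm] := ltnP m (size p); last by rewrite gcoord_high // mul0r.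
apply/eqP; rewrite mulf_eq0; apply/orP; right; apply/eqP.
case: (nat_of_ord m) lem ltpm => [|n] lem ltpm.
  by move: lem; lia.
rewrite mulX_chebU gcoordZ gcoordD !gcoordU; try lia.
have [-> ->] : (i == n.+2) = false /\ (i == n) = false by lia.
by rewrite addr0 mulr0.
Qed.

Lemma ucoord_mulXn M j k i : (k + j < M)%N -> (i + j.+2 < k)%N ->
  ucoord M ('X^j * T k) i = 0.
Proof.
elim: j i => [|j IHj] i lt_M lti.
  rewrite expr0 mul1r; apply: ucoord_chebT; lia.
rewrite exprS -mulrA; apply: (@ucoord_mulX _ _ k j.+2) => //; last first.
  by move=> m ltm; apply: IHj => //; lia.
rewrite mulrC size_mulXn ?size_chebT; first by lia.
by rewrite -size_poly_eq0 size_chebT.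
Qed.

Lemma zeta_double_cos N k : (0 < N)%N ->
  zeta R N ^+ k + zeta R N ^- k = 2 * (cos (k%:R * pi / N%:R))%:C.
Proof.
move=> N0; rewrite zetaX; set t := _ / _.
have -> : (cos t +i* sin t)^-1 = cos t -i* sin t :> C.
  have inv : (cos t +i* sin t) * (cos t -i* sin t) = 1 :> C.
    apply/eqP; rewrite eq_complex /= mulrN opprK -!expr2 cos2Dsin2 eqxx /=.
    by apply/eqP; ring.
  have n0 : cos t +i* sin t != 0 :> C.
    by apply: contra_eq_neq inv => ->; rewrite mul0r eq_sym oner_eq0.
  by apply: (mulfI n0); rewrite inv divff.
by apply/eqP; rewrite eq_complex /=; apply/andP; split; apply/eqP; ring.
Qed.

Lemma zetaX_reflect N j k : (0 < N)%N -> (k <= 2 * N)%N ->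
  zeta R N ^+ (j * (2 * N - k)) = zeta R N ^- (j * k).
Proof.
move=> N0 lek; have z0 : zeta R N ^+ (j * k) != 0.
  by rewrite expf_neq0 // zeta_neq0.
apply: (mulIf z0); rewrite -exprD -mulnDr subnK // mulVf // mulnC.
by rewrite exprM zeta_period // expr1n.
Qed.

Lemma cos_reflect N j k : (0 < N)%N -> (k <= 2 * N)%N ->
  cos ((j * (2 * N - k))%:R * pi / N%:R) = cos ((j * k)%:R * pi / N%:R) :> R.
Proof.
move=> N0 lek; suff H : (cos ((j * (2 * N - k))%:R * pi / N%:R))%:C
    = (cos ((j * k)%:R * pi / N%:R))%:C :> C.
  exact: complexI H.
have two : (2 : C) != 0 by rewrite pnatr_eq0.
apply: (mulfI two); rewrite -!zeta_double_cos // zetaX_reflect // invrK.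
by rewrite addrC.
Qed.

Lemma sum_fold (V : nmodType) N (G : nat -> V) : (0 < N)%N ->
  \sum_(k < 2 * N) G k = \sum_(k < N.+1)
    (G k + if (k == 0 :> nat) || (k == N :> nat) then 0 else G (2 * N - k)%N).
Proof.
case: N => [//|n] _; rewrite big_split /=.
have -> : (2 * n.+1 = n.+2 + n)%N by lia.
rewrite big_split_ord /=; congr (_ + _).
rewrite [RHS]big_ord_recl /= add0r big_ord_recr /= /bump leq0n add1n eqxx addr0.
rewrite (reindex_inj rev_ord_inj) /=; apply: eq_bigr => k _.
rewrite add1n eqSS ltn_eqF //; congr G; have := ltn_ord k; lia.
Qed.

(** Coefficients k and 2 N - k of the transform multiply the same function of
    the node, cos (j k pi / N), and are merged; 0 and N stand alone. *)
Definition cheb_coef N (x : nat -> C) k : C :=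
  dft N x k + if (k == 0%N) || (k == N) then 0 else dft N x (2 * N - k).

(** Evaluate the inverse transform at j and at 2 N - j, where x takes the same
    value, and average: the powers of zeta become cosines, that is values of
    Chebyshev polynomials at the nodes. *)
Lemma cheb_interpolation N (x : nat -> C) j : (0 < N)%N -> (j <= N)%N ->
  (forall m, (m <= 2 * N)%N -> x (2 * N - m)%N = x m) ->
  \sum_(k < N.+1) cheb_coef N x k * (cos ((j * k)%:R * pi / N%:R))%:C = x j.
Proof.
move=> N0 lej xsym; have two : (2 : C) != 0 by rewrite pnatr_eq0.
pose G k := dft N x k * (cos ((j * k)%:R * pi / N%:R))%:C.
rewrite (eq_bigr (fun k : 'I_N.+1 => G k +
  if (k == 0 :> nat) || (k == N :> nat) then 0 else G (2 * N - k)%N)).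
  2: {
    move=> k _; rewrite /cheb_coef mulrDl; congr (_ + _).
    case: ifP => _; first by rewrite mul0r.
    by rewrite /G cos_reflect //; have := ltn_ord k; lia. }
rewrite -sum_fold // {}/G; apply: (mulfI two); rewrite mulr_sumr.
under eq_bigr => k _ do rewrite mulrCA -zeta_double_cos // mulrDr.
rewrite big_split /=.
have ltj : (j < 2 * N)%N by lia.
rewrite (eq_bigr (fun k : 'I_(2 * N) => zeta R N ^+ (j * k) * dft N x k)).
  2: by move=> k _; rewrite mulrC.
rewrite dft_inversion // [RHS]mulr_natl mulr2n; congr (_ + _).
have [->|j0] := eqVneq j 0%N.
  rewrite -[RHS](dft_inversion x (_ : 0 < 2 * N)%N); last by lia.
  by apply: eq_bigr => k _; rewrite mul0n expr0 invr1 mulrC.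
have lt2 : (2 * N - j < 2 * N)%N by lia.
rewrite -(xsym j (ltnW ltj)) -(dft_inversion x lt2).
apply: eq_bigr => k _; rewrite mulrC mulnC -zetaX_reflect ?(ltnW ltj) //.
by rewrite mulnC.
Qed.

End Chebyshev.

(** * The differential operator of the Levin equation *)

Section LevinOperator.
Variable R : realType.
Local Notation C := R[i].
Local Notation T := (chebT C).
Local Notation U := (chebU C).
Local Notation ucoord := (gcoord U).
Implicit Types (g p q : {poly C}) (omega : R).

(** The operator p |-> p' + i omega g' p, the derivative of p e^(i omega g)
    divided by e^(i omega g). *)
Definition levin_op g omega p : {poly C} :=
  p^`() + ('i * omega%:C) *: (g^`() * p).

Lemma levin_op0 g omega : levin_op g omega 0 = 0.
Proof. by rewrite /levin_op deriv0 mulr0 scaler0 addr0. Qed.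

Lemma levin_op_sum g omega n (a : nat -> C) (P : nat -> {poly C}) :
  levin_op g omega (\sum_(k < n) a k *: P k) =
  \sum_(k < n) a k *: levin_op g omega (P k).
Proof.
rewrite /levin_op raddf_sum mulr_sumr scaler_sumr -big_split /=.
apply: eq_bigr => k _; rewrite derivZ scalerDr -scalerAr !scalerA.
by rewrite [a k * _]mulrC.
Qed.

Lemma levin_op_expand g omega h p : (size g <= h.+2)%N ->
  levin_op g omega p = p^`() + \sum_(j < h.+1)
    ('i * omega%:C * (j.+1%:R * g`_j.+1)) *: ('X^j * p).
Proof.
move=> leg; rewrite /levin_op; congr (_ + _).
have le_g' : (size g^`() <= h.+1)%N by apply: leq_trans (size_poly _ _) _; lia.
have -> : g^`() = \sum_(j < h.+1) g^`()`_j *: 'X^j.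
  rewrite -poly_def; apply/polyP => j; rewrite coef_poly.
  by case: ltnP => // lej; rewrite nth_default // (leq_trans le_g').
rewrite mulr_suml scaler_sumr; apply: eq_bigr => j _.
by rewrite coef_deriv -scalerAl scalerA mulr_natl.
Qed.

Lemma imaginary_neq0 : 'i != 0 :> C.
Proof. by rewrite eq_complex /= oner_eq0 andbF. Qed.

(** The summand g' p dominates p'. *)
Lemma size_levin_op g omega h p : size g = h.+2 -> omega != 0 -> p != 0 ->
  size (levin_op g omega p) = (size p + h)%N.
Proof.
move=> sg w0 p0.
have g'0 : (g^`())`_h != 0.
  rewrite coef_deriv -mulr_natr mulf_neq0 ?pnatr_eq0 //.
  by rewrite -[h.+1]/(h.+2.-1) -sg lead_coef_eq0 -size_poly_eq0 sg.
have sg' : size g^`() = h.+1.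
  apply/eqP; rewrite eqn_leq; apply/andP; split.
    by apply: leq_trans (size_poly _ _) _; rewrite sg.
  by rewrite ltnNge; apply/negP => /leq_sizeP/(_ h (leqnn _))/eqP; apply/negP.
have s1 : size (('i * omega%:C) *: (g^`() * p)) = (size p + h)%N.
  rewrite size_scale; last first.
    by rewrite mulf_neq0 ?imaginary_neq0 // eq_complex /= eqxx andbT.
  by rewrite size_mul ?sg' -?size_poly_eq0 ?sg' ?size_poly_eq0 //= addnC.
rewrite /levin_op addrC size_polyDl s1 //.
apply: leq_trans (lt_size_deriv p0) _; exact: leq_addr.
Qed.

Lemma sum_delta n (a : nat -> C) (i : nat) :
  \sum_(j < n) a j * (i == j :> nat)%:R = if (i < n)%N then a i else 0.
Proof.
elim: n => [|n IHn]; first by rewrite big_ord0.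
rewrite big_ord_recr /= IHn ltnS.
by case: ltngtP => // [lt|lt|->]; rewrite ?mulr0 ?mulr1 ?addr0 ?add0r.
Qed.

(** Translates the output of back substitution, which is about coordinates,
    into an identity of polynomials. *)
Lemma division_of_coords g omega M n h (P : {poly C}) (a rem : nat -> C) :
  (size P <= M)%N -> (h <= M)%N ->
  (forall k, (k < n)%N -> (size (levin_op g omega (T k)) <= M)%N) ->
  (forall i, (i < M)%N -> ucoord M P i =
    \sum_(k < n) a k * ucoord M (levin_op g omega (T k)) i +
    (if (i < h)%N then rem i else 0)) ->
  P = levin_op g omega (\sum_(k < n) a k *: T k) + \sum_(i < h) rem i *: U i.
Proof.
move=> leP leh leL Pi; rewrite levin_op_sum.
set Q := _ + _; have leQ : (size Q <= M)%N.
  apply: leq_trans (size_polyD _ _) _; rewrite geq_max; apply/andP.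
  split; apply: leq_trans (size_sum _ _ _) _; apply/bigmax_leqP => i _;
    apply: leq_trans (size_scale_leq _ _) _; first exact: leL.
  by rewrite size_chebU; apply: leq_trans leh.
rewrite (gcoordK (size_chebU R) leP) (gcoordK (size_chebU R) leQ).
apply: eq_bigr => i _; congr (_ *: _).
rewrite Pi // gcoordD (gcoord_sum _ _ _ _ (fun k => levin_op g omega (T k))).
rewrite (gcoord_sum _ _ _ _ U) -sum_delta; congr (_ + _).
apply: eq_bigr => j _; rewrite (gcoord_e (size_chebU R)) //.
by apply: leq_trans leh.
Qed.

Definition nodal nu : {poly C} :=
  \prod_(m < nu.+2) ('X - (cc_point R nu m)%:C%:P).

Lemma size_nodal nu : size (nodal nu) = nu.+3.
Proof. by rewrite size_prod_XsubC -[index_enum _]enumT -cardE card_ord. Qed.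

Lemma nodal_node nu m : (m < nu.+2)%N ->
  (nodal nu).[(cc_point R nu m)%:C] = 0.
Proof.
move=> ltm; apply/eqP; rewrite horner_prod prodf_seq_eq0; apply/hasP.
exists (Ordinal ltm); first exact: mem_index_enum.
by rewrite /= hornerXsubC subrr.
Qed.

(** The homogeneous collocation equations have only the trivial solution. *)
Definition unisolvent nu g omega := forall a : nat -> C,
  (forall m, (m < nu.+2)%N -> (levin_op g omega
    (\sum_(k < nu.+2) a k *: T k)).[(cc_point R nu m)%:C] = 0) ->
  forall k, (k < nu.+2)%N -> a k = 0.

(** If y combines the remainders of the w x^j to zero, then w q = L p with
    q = sum y_j x^j.  So L p vanishes at the nodes, p = 0 by unisolvence, and
    w q = 0 forces y = 0. *)
Lemma remainder_nonsingular nu g omega h (a rem : nat -> nat -> C) :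
  unisolvent nu g omega ->
  (forall j, (j < h)%N -> nodal nu * 'X^j =
    levin_op g omega (\sum_(k < nu.+2) a j k *: T k)
    + \sum_(i < h) rem j i *: U i) ->
  nonsingular h (fun i j => rem j i).
Proof.
move=> uni div y y0 j ltj.
pose A k := \sum_(j < h) y j * a j k.
pose q : {poly C} := \poly_(j < h) y j.
have qE : nodal nu * q = levin_op g omega (\sum_(k < nu.+2) A k *: T k).
  rewrite /q poly_def mulr_sumr.
  transitivity (levin_op g omega
      (\sum_(j < h) y j *: \sum_(k < nu.+2) a j k *: T k)
    + \sum_(j < h) y j *: \sum_(i < h) rem j i *: U i).
    rewrite (levin_op_sum _ _ _ _ (fun j => \sum_(k < nu.+2) a j k *: T k)).
    rewrite -big_split /=; apply: eq_bigr => i _.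
    by rewrite -scalerAr div // scalerDr.
  rewrite [X in _ + X](_ : _ = 0) ?addr0; last first.
    under eq_bigr => i _ do rewrite scaler_sumr.
    rewrite exchange_big big1 //= => i _.
    under eq_bigr => m _ do rewrite scalerA mulrC.
    by rewrite -scaler_suml y0 ?scale0r.
  congr levin_op; under eq_bigr => i _ do rewrite scaler_sumr.
  rewrite exchange_big; apply: eq_bigr => k _ /=; rewrite scaler_suml.
  by apply: eq_bigr => i _; rewrite scalerA.
have A0 k : (k < nu.+2)%N -> A k = 0.
  by apply: uni => m ltm; rewrite -qE hornerM nodal_node // mul0r.
have : nodal nu * q == 0.
  by rewrite qE big1 ?levin_op0 // => k _; rewrite A0 // scale0r.
rewrite mulf_eq0 -size_poly_eq0 size_nodal /= => /eqP q0.
by have := coef_poly h y j; rewrite -/q q0 coef0 ltj.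
Qed.

Lemma nonsingular_solvable n (b : nat -> nat -> C) (c : nat -> C) :
  nonsingular n b -> exists z : nat -> C,
    forall i, (i < n)%N -> \sum_(j < n) b i j * z j = c i.
Proof.
move=> nsb; pose A : 'M[C]_n := \matrix_(i, j) b j i.
have Aunit : A \in unitmx.
  rewrite -row_free_unit; apply: inj_row_free => v vA.
  have v0 := nsb (fun j => if insub j is Some k then v 0 k else 0).
  apply/rowP => j; rewrite mxE; have := v0 _ j (ltn_ord j).
  rewrite valK; apply => i lti.
  have /rowP/(_ (Ordinal lti)) := vA; rewrite !mxE => vAi; rewrite -[RHS]vAi.
  by apply: eq_bigr => k _; rewrite valK mxE mulrC.
pose z := (\row_j c j) *m invmx A.
exists (fun j => if insub j is Some k then z 0 k else 0) => i lti.
have /rowP/(_ (Ordinal lti)) : z *m A = \row_j c j by rewrite mulmxKV.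
rewrite mxE [RHS]mxE => <-; apply: eq_bigr => k _.
by rewrite valK [A _ _]mxE mulrC.
Qed.

End LevinOperator.

(** * Unisolvence for large frequencies *)

Section Unisolvence.
Variable R : realType.
Local Notation C := R[i].
Local Notation T := (chebT C).

Lemma levin_op_node (g : {poly C}) omega n (a : nat -> C) (c : C) :
  (levin_op g omega (\sum_(k < n) a k *: T k)).[c] =
  \sum_(k < n) a k * ((T k)^`().[c] + 'i * omega%:C * g^`().[c] * (T k).[c]).
Proof.
rewrite levin_op_sum horner_sum; apply: eq_bigr => k _.
by rewrite /levin_op hornerZ hornerD hornerZ hornerM mulrA.
Qed.

(** A real number exceeding the sum of the moduli of the real parts of the roots
    is not the opposite of a root. *)
Lemma roots_bounded (p : {poly C}) : p != 0 ->
  exists2 x0 : R, 0 < x0 & forall x, x0 <= x -> ~~ root p (- x%:C).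
Proof.
move=> p0; have [r rE] := closed_field_poly_normal p.
pose x0 : R := 1 + \sum_(z <- r) `|complex.Re z|.
have sum0 : 0 <= \sum_(z <- r) `|complex.Re z| :> R by apply: sumr_ge0.
exists x0 => [|x lex]; first by rewrite ltr_pwDl.
rewrite rE rootZ ?lead_coef_eq0 // root_prod_XsubC; apply/negP => xr.
have : `|x| <= \sum_(z <- r) `|complex.Re z|.
  rewrite (big_rem _ xr) /= normrN lerDl.
  by apply: sumr_ge0.
move/(le_trans (ler_norm x)); rewrite leNgt => /negP; apply.
by apply: lt_le_trans lex; rewrite ltrDr.
Qed.

Variable nu : nat.
Local Notation node m := (cc_point R nu m)%:C.

Definition cheb_matrix : 'M[C]_nu.+2 := \matrix_(m, k) (T k).[node m].

(** Interpolating the unit vectors gives a right inverse. *)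
Lemma cheb_matrix_unit : cheb_matrix \in unitmx.
Proof.
(* The unit vectors are extended to even sequences of period 2 (nu + 1). *)
pose fold m := if (m <= nu.+1)%N then m else (2 * nu.+1 - m)%N.
pose X : 'M[C]_nu.+2 :=
  \matrix_(k, m) cheb_coef nu.+1 (fun j => (fold j == m :> nat)%:R) k.
suff : cheb_matrix *m X = 1%:M by case/mulmx1_unit.
apply/matrixP => j m; rewrite !mxE.
have <- : (fold j == m :> nat)%:R = (j == m)%:R :> C.
  by rewrite /fold -ltnS ltn_ord.
rewrite -(@cheb_interpolation _ nu.+1 (fun j => (fold j == m :> nat)%:R) j) //.
- apply: eq_bigr => k _; rewrite !mxE mulrC; congr (_ * _).
  rewrite chebT_cos; congr (cos _)%:C; rewrite natrM /cc_point; ring.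
- by rewrite -ltnS ltn_ord.
move=> i lei; congr (_ == _)%:R; rewrite /fold.
by case: (leqP i) => ?; case: (leqP (2 * nu.+1 - i)%N) => ?; lia.
Qed.

(** A homogeneous solution v satisfies A v + omega B v = 0, hence is an
    eigenvector of B^-1 A for the eigenvalue - omega. *)
Lemma unisolvent_eventually (g : {poly C}) :
  (forall m, (m < nu.+2)%N -> g^`().[node m] != 0) ->
  exists omega0 : R, forall omega, omega0 <= omega ->
    omega != 0 /\ unisolvent nu g omega.
Proof.
move=> g'0.
pose A : 'M[C]_nu.+2 := \matrix_(m, k) (T k)^`().[node m].
pose D : 'rV[C]_nu.+2 := \row_m ('i * g^`().[node m]).
pose B := diag_mx D *m cheb_matrix.
have Bunit : B \in unitmx.
  rewrite unitmx_mul cheb_matrix_unit andbT unitmxE det_diag unitfE.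
  apply/prodf_neq0 => m _; rewrite mxE mulf_neq0 ?imaginary_neq0 ?g'0 //.
pose E := (invmx B *m A)^T.
have [omega0 omega0_gt0 noroot] :=
  roots_bounded (monic_neq0 (char_poly_monic E)).
exists omega0 => omega le_omega; split.
  by rewrite gt_eqF // (lt_le_trans omega0_gt0).
move=> a a0 k ltk; pose v : 'cV[C]_nu.+2 := \col_k a k.
have ABv : A *m v + omega%:C *: (B *m v) = 0.
  apply/colP => m; rewrite /B -mulmxA mul_diag_mx !mxE.
  rewrite -[RHS](a0 m (ltn_ord m)) levin_op_node !mulr_sumr -big_split /=.
  by apply: eq_bigr => j _; rewrite !mxE; ring.
have Ev : v^T *m E = - omega%:C *: v^T.
  rewrite /E -trmx_mul -linearZ; congr (_^T).
  rewrite -mulmxA -[RHS](mulKmx Bunit) -scalemxAr; congr (_ *m _).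
  by apply/eqP; rewrite scaleNr -subr_eq0 opprK ABv.
apply/eqP/negPn/negP => ak; have /negP := noroot _ le_omega; apply.
rewrite -eigenvalue_root_char; apply/eigenvalueP; exists v^T => //.
apply: contra_neq ak => /rowP/(_ (Ordinal ltk)).
by rewrite !mxE.
Qed.

End Unisolvence.

(** * Computing the matrix of the operator and the interpolant *)

Section LevinComputation.
Local Open Scope classical_set_scope.
Variables (R : realType) (h nu : nat).
Local Notation C := R[i].
Local Notation T := (chebT C).
Local Notation U := (chebU C).
Local Notation M := (nu.+2 + h)%N.
Local Notation ucoord := (gcoord U M).
Local Notation input := ({poly C} * R * (R -> C))%type.

(** The inputs (g, omega, f) on which the program has to be correct.  A large
    omega ensures the last two conditions. *)
Definition admissible : set input := [set s : input |
  [/\ size s.1.1 = h.+2, s.1.2 != 0 & unisolvent nu s.1.1 s.1.2]].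

Definition omega_in (s : input) : C := s.1.2%:C.
Definition coef_in (j : nat) (s : input) : C := s.1.1`_j.
Definition sample_in (m : nat) (s : input) : C := s.2 (cc_point R nu m).

Definition known_input : set (input -> C) :=
  [set omega_in] `|` upto h.+2 coef_in `|` upto nu.+2 sample_in.

Definition op_coord k i (s : input) := ucoord (levin_op s.1.1 s.1.2 (T k)) i.

Definition op_band : set (input -> C) := [set x | exists k i,
  [/\ (k < nu.+2)%N, in_band (h + 2) h k i & op_coord k i = x]].

(** The coordinates of T_k' and of x^j T_k do not depend on the input: they are
    constants of the program. *)
Lemma op_coordE s k i : admissible s -> op_coord k i s =
  ucoord (deriv (T k)) i + \sum_(j < h.+1)
    ucoord ('X^j * T k) i * ('i * s.1.2%:C * (j.+1%:R * s.1.1`_j.+1)).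
Proof.
case=> sg _ _; rewrite /op_coord (@levin_op_expand _ _ _ h) ?sg // gcoordD.
congr (_ + _); rewrite (gcoord_sum _ _ _ _ (fun j => 'X^j * T k)
  (fun j => 'i * s.1.2%:C * (j.+1%:R * s.1.1`_j.+1))).
by apply: eq_bigr => j _; rewrite mulrC.
Qed.

(** The derivative contributes row k - 1 only, and x^j T_k, j <= h, contributes
    rows k - 2 - j to k + j. *)
Lemma op_coord_band s k i : admissible s -> (k < nu.+2)%N ->
  ~~ in_band (h + 2) h k i -> op_coord k i s = 0.
Proof.
move=> adm ltk out; have [sg w0 _] := adm.
have Tk0 : T k != 0 by rewrite -size_poly_eq0 size_chebT.
have [lti|lei] := ltnP (k + h)%N i.
  apply: gcoord_high.
  by rewrite (size_levin_op sg) // size_chebT; lia.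
move: out; rewrite /in_band lei andbT -ltnNge => lt.
rewrite op_coordE // ucoord_deriv ?add0r; try lia.
rewrite big1 // => j _; rewrite ucoord_mulXn ?mul0r //.
  by have := ltn_ord j; lia.
by have := ltn_ord j; lia.
Qed.

Lemma op_coord_pivot s k : admissible s -> (k < nu.+2)%N ->
  op_coord k (k + h)%N s != 0.
Proof.
move=> [sg w0 _] ltk; apply: (gcoord_lead (size_chebU R)); first by lia.
by rewrite (size_levin_op sg) ?size_chebT // -size_poly_eq0 size_chebT.
Qed.

Lemma computes_operator :
  computes admissible (2 + (h.+1 * 3 + nu.+2 * ((2 * h + 3) * (3 * h + 6))))
    known_input op_band.
Proof.
pose iw s := 'i * omega_in s.
pose e j s := iw s * (j.+1%:R * coef_in j.+1 s).
apply: (@computes_chain _ _ _ _ [set iw]).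
  by apply: computes_scale; left; left.
apply: (@computes_chain _ _ _ _ (upto h.+1 e)).
  apply: computes_upto => j ltj.
  pose gj s := j.+1%:R * coef_in j.+1 s.
  apply: (@computes_chain _ _ _ _ [set gj] _ 2 1).
    by apply: computes_scale; left; left; right; apply: uptoP.
  by apply: computes_mul; [left; right | right].
(* For k < h + 2 truncation starts at row 0 and these 2 h + 3 rows reach
   beyond the band, which does no harm. *)
pose idx k j := (k - (h + 2) + j)%N.
have band : computes admissible (nu.+2 * ((2 * h + 3) * (3 * h + 6)))
    (known_input `|` [set iw] `|` upto h.+1 e)
    (\bigcup_(k in `I_nu.+2) upto (2 * h + 3) (fun j => op_coord k (idx k j))).
  apply: computes_bigcup => k ltk; apply: computes_upto => j ltj.
  set i := idx k j; pose c : C := ucoord (deriv (T k)) i.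
  pose lin s := \sum_(j < h.+1) ucoord ('X^j * T k) i * e j s.
  have linP : computes admissible (3 * h.+1).+1
      (known_input `|` [set iw] `|` upto h.+1 e) [set lin].
    apply: (@computes_lincomb _ _ admissible _ h.+1
      (fun j => ucoord ('X^j * T k) i) e).
    by move=> u uP; right.
  have sumP := computes_add admissible
    (or_introl (or_intror erefl) : ((known_input `|` [set iw] `|` upto h.+1 e)
      `|` [set fun=> c] `|` [set lin]) (fun=> c))
    (or_intror erefl : ((known_input `|` [set iw] `|` upto h.+1 e)
      `|` [set fun=> c] `|` [set lin]) lin).
  have linP' : computes admissible (3 * h.+1).+1
      ((known_input `|` [set iw] `|` upto h.+1 e) `|` [set fun=> c]) [set lin].
    by apply: computes_sub linP _ _ _.
  have allP := computes_chain (computes_const admissible _ c)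
    (computes_chain linP' sumP).
  apply: computesW allP _ _ _ _ => //; first by lia.
  move=> _ ->; exists (fun s => c + lin s); first by right.
  by move=> s adm; rewrite op_coordE.
apply: computes_sub band _ _ _ => // _ [k [i [ltk ib <-]]]; right.
exists k => //; exists (i - (k - (h + 2)))%N => /=.
  by move: ib; rewrite /in_band; lia.
by congr op_coord; rewrite /idx; move: ib; rewrite /in_band; lia.
Qed.

Definition data_coef k (s : input) : C :=
  cheb_coef nu.+1 (fun m => sample_in m s) k.

Definition interpolant (s : input) : {poly C} :=
  \sum_(k < nu.+2) data_coef k s *: T k.

(** The even extension needs no further data, as f is evaluated at the same
    real number. *)
Lemma sample_reflect m : (m <= 2 * nu.+1)%N ->
  sample_in (2 * nu.+1 - m) = sample_in m.
Proof.
move=> lem; apply/funext => s; rewrite /sample_in /cc_point; congr (s.2 _).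
by have := @cos_reflect R nu.+1 1 m isT lem; rewrite !mul1n.
Qed.

Lemma interpolant_node s m : (m < nu.+2)%N ->
  (interpolant s).[(cc_point R nu m)%:C] = s.2 (cc_point R nu m).
Proof.
move=> ltm; rewrite horner_sum -[RHS]/(sample_in m s).
have <- := @cheb_interpolation _ nu.+1 (fun m => sample_in m s) m isT ltm _.
  2: by move=> k lek; rewrite sample_reflect.
apply: eq_bigr => k _; rewrite hornerZ chebT_cos; congr (_ * (cos _)%:C).
by rewrite natrM; ring.
Qed.

Definition dft_cost l :=
  (6 * l.+1 * 2 ^ l.+1 + 2 * 2 ^ l.+1 + 12 * nu.+1 + 1)%N.

Lemma computes_data_coef l : (4 * nu.+1 <= 2 ^ l.+1)%N ->
  computes admissible (dft_cost l + nu.+2) known_input (upto nu.+2 data_coef).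
Proof.
move=> lel; pose F k (s : input) := dft nu.+1 (fun m => sample_in m s) k.
apply: (@computes_chain _ _ _ _ (upto (2 * nu.+1) F)).
  apply: (computes_dft admissible (ltn0Sn nu) lel).
  move=> _ [m /= ltm <-]; right; have [lem|gtm] := leqP m nu.+1.
    by apply: uptoP.
  by rewrite -sample_reflect; [apply: uptoP | ]; lia.
set X := known_input `|` _.
suff comp : computes admissible (nu.+2 * 1) X (upto nu.+2 data_coef).
  by apply: computes_sub comp _ _ _; rewrite // muln1.
apply: computes_upto => k ltk.
have FP j : (j < 2 * nu.+1)%N -> X (F j).
  by move=> ltj; right; apply: uptoP.
have [k0|k0] := boolP ((k == 0%N) || (k == nu.+1)).
  apply: computesW (computes0 admissible X) _ _ _ _ => // _ ->.
  exists (F k); first by left; apply: FP; lia.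
  by move=> s _; rewrite /data_coef /cheb_coef k0 addr0.
have lt1 : (k < 2 * nu.+1)%N by lia.
have lt2 : (2 * nu.+1 - k < 2 * nu.+1)%N by lia.
apply: computesW (computes_add admissible (FP _ lt1) (FP _ lt2)) _ _ _ _ => //.
move=> _ ->; exists (fun s => F k s + F (2 * nu.+1 - k)%N s); first by right.
by move=> s _; rewrite /data_coef /cheb_coef (negPf k0).
Qed.

(** Row i involves T_i and T_(i+2) only. *)
Lemma computes_interpolant l : (4 * nu.+1 <= 2 ^ l.+1)%N ->
  computes admissible (dft_cost l + nu.+2 + (1 + M * 5)) known_input
    (upto M (fun i s => ucoord (interpolant s) i)).
Proof.
move=> lel; apply: (computes_chain (computes_data_coef lel)).
set X := known_input `|` _.
(* Padding by zero makes the formula for row i uniform in i. *)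
pose a k s : C := if (k < nu.+2)%N then data_coef k s else 0.
apply: (computes_chain (computes_const admissible X 0)).
apply: computes_upto => i lti; set Y := X `|` _.
have aP k : Y (a k).
  have [ltk|gek] := boolP (k < nu.+2)%N.
    have -> : a k = data_coef k by apply/funext => s; rewrite /a ltk.
    by left; right; apply: uptoP.
  by right; apply/funext => s; rewrite /a (negPf gek).
pose term k s := ucoord (T k) i * a k s.
have one k : computes admissible 2 Y [set term k] by apply: computes_scale.
have sumP : computes admissible 1 (Y `|` ([set term i] `|` [set term i.+2]))
    [set fun s => term i s + term i.+2 s].
  by apply: computes_add; right; [left | right].
apply: computesW (computes_chain (computes_union (one i) (one i.+2)) sumP)
  _ _ _ _ => // _ ->.
exists (fun s => term i s + term i.+2 s); first by right.
move=> s _; rewrite /interpolant (gcoord_sum _ _ _ _ T (data_coef^~ s)).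
have delta k0 : \sum_(k < nu.+2) (ucoord (T k) i * data_coef k s) *
    (k0 == k :> nat)%:R = term k0 s.
  rewrite (sum_delta _ (fun k => ucoord (T k) i * data_coef k s)) /term /a.
  by case: ifP; rewrite ?mulr0.
rewrite -!delta -big_split /=; apply: eq_bigr => k _.
have [<-|ik] := eqVneq i k;
  first by rewrite gtn_eqF //= mulr0 addr0 mulr1 mulrC.
have [<-|ik2] := eqVneq i.+2 k; first by rewrite /= mulr0 add0r mulr1 mulrC.
by rewrite /= ucoord_chebT ?mulr0 ?addr0 //; have := ltn_ord k; lia.
Qed.

End LevinComputation.

(** * Solving the collocation equations *)

Section LevinSolver.
Local Open Scope classical_set_scope.
Variables (R : realType) (h nu : nat).
Local Notation C := R[i].
Local Notation T := (chebT C).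
Local Notation U := (chebU C).
Local Notation M := (nu.+2 + h)%N.
Local Notation ucoord := (gcoord U M).
Local Notation input := ({poly C} * R * (R -> C))%type.
Local Notation adm := (@admissible R h nu).
Local Notation known := (@known_input R h nu).

Definition division_cost := (nu.+2 * (2 * (h + 2 + h) + 1))%N.

(** Both the data and the operator depend on the input; the pivots are nonzero
    on every admissible one. *)
Lemma computes_division (X : set (input -> C)) (P : input -> {poly C}) :
  (forall s, adm s -> (size (P s) <= M)%N) ->
  @op_band R h nu `<=` X -> upto M (fun i s => ucoord (P s) i) `<=` X ->
  exists a rem : nat -> input -> C,
    (forall s, adm s ->
      P s = levin_op s.1.1 s.1.2 (\sum_(k < nu.+2) a k s *: T k)
            + \sum_(i < h) rem i s *: U i)
    /\ computes adm division_cost X (upto nu.+2 a `|` upto h rem).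
Proof.
move=> leP opX PX.
have [k i ltk ib|s k i|s k|//|a [rem [E comp]]] :=
  @computes_back_substitution R input adm X h (h + 2) nu.+2
    (@op_coord R h nu) (fun i s => ucoord (P s) i).
- by apply: opX; exists k, i.
- exact: op_coord_band.
- exact: op_coord_pivot.
exists a, rem; split=> // s sadm; have [sg w0 _] := sadm.
apply: (@division_of_coords _ _ _ M _ _ _ (a^~ s) (rem^~ s)) => [||k ltk|i lti].
- exact: leP.
- exact: leq_addl.
- by rewrite (size_levin_op sg) -?size_poly_eq0 ?size_chebT //; lia.
exact: E.
Qed.

(** In order: the operator, the interpolant, the coordinates of the w x^j, the
    division of the interpolant, the divisions of the w x^j, the dense system,
    and the recombination of the quotients. *)
Definition levin_cost l :=
  ((2 + (h.+1 * 3 + nu.+2 * ((2 * h + 3) * (3 * h + 6))))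
   + ((dft_cost nu l + nu.+2 + (1 + M * 5))
   + (h * (M * 1)
   + (division_cost
   + (h * division_cost
   + (4 * h ^ 3
   + nu.+2 * ((2 * h).+1 + 1)))))))%N.

(** With F = L p0 + rem0 and w x^j = L p_j + rem_j, the z solving
    sum z_j rem_j = rem0 gives L (p0 - sum z_j p_j) = F - w sum z_j x^j, which
    agrees with f at the nodes. *)
Lemma computes_levin l : (4 * nu.+1 <= 2 ^ l.+1)%N ->
  exists alpha : nat -> input -> C,
    (forall s, adm s -> forall m, (m < nu.+2)%N ->
      (levin_op s.1.1 s.1.2 (\sum_(k < nu.+2) alpha k s *: T k)).[
        (cc_point R nu m)%:C] = s.2 (cc_point R nu m)) /\
    computes adm (levin_cost l) known (upto nu.+2 alpha).
Proof.
move=> lel.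
pose r0 i (s : input) := ucoord (interpolant nu s) i.
pose r j i (s : input) := ucoord (nodal R nu * 'X^j) i.
pose X3 := known `|` @op_band R h nu `|` upto M r0
  `|` \bigcup_(j in `I_h) upto M (r j).
have [s _||u u0|a0 [rem0 [E0 comp0]]] :=
  @computes_division X3 (@interpolant R nu).
- apply: leq_trans (size_sum _ _ _) _; apply/bigmax_leqP => k _.
  apply: leq_trans (size_scale_leq _ _) _; rewrite size_chebT.
  by apply: leq_trans (ltn_ord k) _; apply: leq_addr.
- by move=> u opu; left; left; right.
- by left; right.
pose X4 := X3 `|` (upto nu.+2 a0 `|` upto h rem0).
have division j : exists ar : (nat -> input -> C) * (nat -> input -> C),
    (j < h)%N -> (forall s, adm s -> nodal R nu * 'X^j =
      levin_op s.1.1 s.1.2 (\sum_(k < nu.+2) ar.1 k s *: T k)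
            + \sum_(i < h) ar.2 i s *: U i)
    /\ computes adm division_cost X4 (upto nu.+2 ar.1 `|` upto h ar.2).
  have [ltj|lej] := ltnP j h; last first.
    by exists (fun _ _ => 0, fun _ _ => 0).
  have [s _|||a [rem [E comp]]] :=
    @computes_division X4 (fun=> nodal R nu * 'X^j).
  - rewrite size_mulXn -?size_poly_eq0 size_nodal //; lia.
  - by move=> u opu; left; left; left; right.
  - by move=> u ru; left; right; exists j.
  by exists (a, rem).
have {division}[ar arP] := choice division.
pose a j := (ar j).1; pose rem j := (ar j).2.
have nons s : adm s -> nonsingular h (fun i j => rem j i s).
  move=> sadm; have [_ _ uni] := sadm.
  apply: (@remainder_nonsingular _ _ _ _ _ (fun j k => a j k s)
    (fun j i => rem j i s) uni) => j ltj.
  by have [E _] := arP j ltj; apply: E.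
have solvable_rem s : exists z : nat -> C, adm s ->
    forall i, (i < h)%N -> \sum_(j < h) rem j i s * z j = rem0 i s.
  have [sadm|nadm] := pselect (adm s).
    have [z zP] := nonsingular_solvable (rem0^~ s) (nons s sadm).
    by exists z.
  by exists (fun=> 0).
(* The solution is first chosen input by input; computes_solve then shows
   that this function of the input is computable. *)
have {solvable_rem}[y yP] := choice solvable_rem.
pose z j s := y s j.
pose corr k s := \sum_(j < h) z j s * a j k s.
pose alpha k s := a0 k s - corr k s.
exists alpha; split=> [s sadm m ltm|].
  have -> : \sum_(k < nu.+2) alpha k s *: T k =
      \sum_(k < nu.+2) a0 k s *: T k
      - \sum_(j < h) z j s *: \sum_(k < nu.+2) a j k s *: T k.
    rewrite (eq_bigr (fun k : 'I_nu.+2 =>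
      a0 k s *: T k - corr k s *: T k)) => [|k _]; last by rewrite scalerBl.
    rewrite sumrB; congr (_ - _).
    under [RHS]eq_bigr => j _ do rewrite scaler_sumr.
    rewrite exchange_big; apply: eq_bigr => k _ /=.
    by rewrite scaler_suml; apply: eq_bigr => j _; rewrite scalerA.
  have levinB p q : levin_op s.1.1 s.1.2 (p - q) =
      levin_op s.1.1 s.1.2 p - levin_op s.1.1 s.1.2 q.
    by rewrite /levin_op derivB mulrBr scalerBr opprD addrACA.
  rewrite levinB
    (levin_op_sum _ _ _ _ (fun j => \sum_(k < nu.+2) a j k s *: T k)).
  have -> : levin_op s.1.1 s.1.2 (\sum_(k < nu.+2) a0 k s *: T k) =
      interpolant nu s - \sum_(i < h) rem0 i s *: U i.
    by rewrite (E0 s sadm) addrK.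
  have -> : \sum_(j < h) z j s *:
        levin_op s.1.1 s.1.2 (\sum_(k < nu.+2) a j k s *: T k) =
      nodal R nu * (\sum_(j < h) z j s *: 'X^j)
      - \sum_(i < h) rem0 i s *: U i.
    apply/eqP; rewrite -subr_eq opprK eq_sym; apply/eqP.
    rewrite mulr_sumr.
    have -> : \sum_(i < h) rem0 i s *: U i =
        \sum_(j < h) z j s *: \sum_(i < h) rem j i s *: U i.
      under [RHS]eq_bigr => j _ do rewrite scaler_sumr.
      rewrite exchange_big; apply: eq_bigr => i _ /=.
      rewrite -(yP s sadm i) // scaler_suml; apply: eq_bigr => j _.
      by rewrite scalerA mulrC.
    rewrite -big_split /=; apply: eq_bigr => j _.
    have [E _] := arP j (ltn_ord j).
    by rewrite -scalerAr (E s sadm) scalerDr.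
  rewrite opprB addrA subrK hornerD hornerN hornerM nodal_node // mul0r subr0.
  exact: interpolant_node.
apply: (computes_chain (computes_operator R h nu)).
apply: (@computes_chain _ _ _ _ (upto M r0)).
  by apply: computes_sub (computes_interpolant R h lel) _ _ _.
apply: (@computes_chain _ _ _ _ (\bigcup_(j in `I_h) upto M (r j))).
  apply: computes_bigcup => j ltj; apply: computes_upto => i lti.
  exact: computes_const.
apply: (computes_chain comp0); rewrite -/X3 -/X4.
apply: (@computes_chain _ _ _ _
  (\bigcup_(j in `I_h) (upto nu.+2 (a j) `|` upto h (rem j)))).
  by apply: computes_bigcup => j ltj; have [_] := arP j ltj.
apply: (@computes_chain _ _ _ _ (upto h z)).
  apply: (@computes_solve _ _ _ _ _ (fun i j => rem j i) rem0).
  - by move=> i j lti ltj; right; exists j => //; right; apply: uptoP.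
  - by move=> u u0; left; right; right.
  - exact: nons.
  by move=> s i sadm lti; apply: yP.
apply: computes_upto => k ltk.
apply: (@computes_chain _ _ _ _ [set corr k]).
  apply: (@computes_dot _ _ _ _ h z (fun j => a j k)).
    by move=> u uz; right.
  move=> _ [j ltj <-]; left; right; exists j => //; left; exact: uptoP.
apply: computes_subtract; last by right.
by left; left; left; right; left; apply: uptoP.
Qed.

End LevinSolver.

(** * The complete program and its cost *)

Section LevinProgram.
Local Open Scope classical_set_scope.
Variables (R : realType) (h nu : nat).
Local Notation C := R[i].
Local Notation T := (chebT C).
Local Notation input := ({poly C} * R * (R -> C))%type.
Local Notation adm := (@admissible R h nu).
Local Notation known := (@known_input R h nu).

Definition exponent (e : C) (s : input) : C := 'i * s.1.2%:C * s.1.1.[e].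

Lemma computes_exponent (e : C) :
  computes adm (2 + ((3 * h.+2).+1 + 1)) known [set exponent e].
Proof.
pose iw (s : input) := 'i * omega_in s.
pose ge (s : input) := \sum_(j < h.+2) e ^+ j * coef_in j s.
have iwP : computes adm 2 known [set iw] by apply: computes_scale; left; left.
have geP : computes adm (3 * h.+2).+1 (known `|` [set iw]) [set ge].
  apply: (@computes_lincomb _ _ adm _ h.+2 (fun j => e ^+ j) (@coef_in R)).
  by move=> u uP; left; left; right.
have mulP : computes adm 1 (known `|` [set iw] `|` [set ge])
    [set fun s => iw s * ge s].
  by apply: computes_mul; [left; right | right].
apply: computesW (computes_chain iwP (computes_chain geP mulP)) _ _ _ _ => //.
move=> _ ->; exists (fun s => iw s * ge s); first by right.
move=> s [sg _ _]; rewrite /exponent horner_coef sg; congr (_ * _).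
by apply: eq_bigr => j _; rewrite mulrC.
Qed.

Definition input_memory : seq (input -> C) :=
  @omega_in R :: [seq @coef_in R j | j <- iota 0 h.+2]
  ++ [seq @sample_in R nu m | m <- iota 0 nu.+2].

Lemma input_memoryE s : adm s ->
  [seq x s | x <- input_memory] = levin_input nu s.1.1 s.1.2 s.2.
Proof.
case=> sg _ _; rewrite /levin_input /input_memory map_cons map_cat -!map_comp.
congr cons; congr cat.
by rewrite -[RHS](mkseq_nth 0) /mkseq sg; apply: eq_map.
Qed.

Lemma known_input_stored : known `<=` stored adm input_memory.
Proof.
have nth_map_iota n (x : nat -> input -> C) j : (j < n)%N ->
    nth (fun=> 0) [seq x j | j <- iota 0 n] j = x j.
  by move=> ltj; rewrite (nth_map 0%N) ?size_iota // nth_iota.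
rewrite /known_input /input_memory.
have szl : size [seq @coef_in R j | j <- iota 0 h.+2] = h.+2.
  by rewrite size_map size_iota.
have szr : size [seq @sample_in R nu m | m <- iota 0 nu.+2] = nu.+2.
  by rewrite size_map size_iota.
have lE j := @nth_map_iota h.+2 (@coef_in R) j.
have rE m := @nth_map_iota nu.+2 (@sample_in R nu) m.
move: (map _ (iota 0 h.+2)) (map _ (iota 0 nu.+2)) szl szr lE rE.
move=> cs ss szl szr lE rE _ [[->|[j /= ltj <-]]|[m /= ltm <-]].
- by exists 0%N.
- exists j.+1 => [|s _]; first by rewrite /= ltnS size_cat szl szr; lia.
  by rewrite /= nth_cat szl ltj lE.
exists (h.+2 + m).+1 => [|s _]; first by rewrite /= ltnS size_cat szl szr; lia.
rewrite -[nth _ _ _]/(nth (fun=> 0) (cs ++ ss) (h.+2 + m)) nth_cat.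
by rewrite szl ltnNge leq_addr addKn rE.
Qed.

Definition program_cost l :=
  ((2 + ((3 * h.+2).+1 + 1)) + (2 + ((3 * h.+2).+1 + 1))
   + (levin_cost h nu l + (nu.+3 + ((3 * nu.+2).+1 + (1 + (1 + 1))))).+2)%N.

(** The exponents come first, then the two exponentials, then all the rest:
    computes covers arithmetic and zero tests, so that the exponentials are
    counted apart. *)
Lemma levin_program l : (4 * nu.+1 <= 2 ^ l.+1)%N ->
  exists t : comp_tree R,
    [/\ (operations t <= program_cost l)%N, (exponentials t <= 2)%N &
    exists alpha : nat -> input -> C, forall s, adm s ->
      (forall m, (m < nu.+2)%N ->
        (levin_op s.1.1 s.1.2 (\sum_(k < nu.+2) alpha k s *: T k)).[
          (cc_point R nu m)%:C] = s.2 (cc_point R nu m)) /\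
      run t (levin_input nu s.1.1 s.1.2 s.2) =
        Some (levin_value s.1.1 s.1.2 (\col_(k < nu.+2) alpha k s))].
Proof.
move=> lel; have [alpha [alphaE comp]] := computes_levin R h lel.
pose up s := \sum_(k < nu.+2) alpha k s.
pose dn s := \sum_(k < nu.+2) (-1) ^+ k * alpha k s.
pose E e s := cexp (exponent e s).
pose out s := E 1 s * up s - E (-1) s * dn s.
suff [t [tc te tout]] : solvable adm input_memory (program_cost l) 2 out.
  exists t; split=> //; exists alpha => s sadm; split; first exact: alphaE.
  rewrite -(input_memoryE sadm) tout //; congr Some.
  rewrite /out /levin_value; congr (_ * _ - _ * _); apply: eq_bigr => k _;
    by rewrite mxE.
have args := computes_union (computes_exponent 1) (computes_exponent (-1)).
have adm_refl : adm `<=` adm by [].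
apply: (resume args adm_refl known_input_stored) => S1 K1 sS1 K01 argsK1.
apply: (@solvable_exp _ _ _ _ (exponent 1)).
  by apply: argsK1; left.
apply: (@solvable_exp _ _ _ _ (exponent (-1))).
  by apply: stored_rcons; apply: argsK1; right.
rewrite -/(E 1) -/(E (-1)); set K2 := rcons (rcons _ _) _.
pose X := known `|` [set E 1] `|` [set E (-1)].
have XK2 : X `<=` stored S1 K2.
  move=> u [[uk|->]|->]; last exact: stored_last.
    by do 2! apply: stored_rcons; apply/K01/known_input_stored.
  by apply: stored_rcons; apply: stored_last.
pose Y := X `|` upto nu.+2 alpha.
have rest : computes adm
    (levin_cost h nu l + (nu.+3 + ((3 * nu.+2).+1 + (1 + (1 + 1))))) X
    [set out].
  apply: (@computes_chain _ _ _ _ (upto nu.+2 alpha)).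
    by apply: computes_sub comp _ _ _ => // u uP; left; left.
  apply: (@computes_chain _ _ _ _ [set up]).
    by apply: computes_sum => u uP; right.
  apply: (@computes_chain _ _ _ _ [set dn]).
    apply: (@computes_lincomb _ _ adm _ nu.+2 (fun k => (-1) ^+ k) alpha).
    by move=> u uP; left; right.
  apply: (@computes_chain _ _ _ _ [set fun s => E 1 s * up s]).
    by apply: computes_mul; [do 4! left; right | left; right].
  apply: (@computes_chain _ _ _ _ [set fun s => E (-1) s * dn s]).
    by apply: computes_mul; [do 4! left; right | left; right].
  by apply: computes_subtract; [left; right | right].
rewrite -[X in solvable _ _ X]addn0.
apply: (resume rest sS1 XK2) => S2 K3 _ _ outK3.
by apply: solvable_return; apply: outK3.
Qed.

(** The transforms cost at most 8 (l + 1) 2 ^ (l + 1), and 96 = 8 * 12.  The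
    other terms are multiples of nu, d nu, d^2 nu or d^3, and d = h + 1 < nu. *)
Lemma program_cost_bound l : (h.+2 <= nu)%N -> (2 ^ l.+1 <= 12 * nu)%N ->
  (program_cost l <= 96 * (l.+1 * nu) + 500 * (h.+1 ^ 2 * nu))%N.
Proof.
move=> leh lel.
rewrite /program_cost /levin_cost /dft_cost /division_cost.
have fft : (6 * l.+1 * 2 ^ l.+1 + 2 * 2 ^ l.+1 <= 96 * (l.+1 * nu))%N.
  by nia.
have nu1 : (nu <= h.+1 * nu)%N by rewrite leq_pmull.
have nu2 : (h.+1 * nu <= h.+1 ^ 2 * nu)%N.
  by rewrite expnS expn1 -mulnA leq_pmull.
have h2 : (h.+1 ^ 2 <= h.+1 * nu)%N.
  by rewrite expnS expn1 leq_mul2l; lia.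
have h3 : (h.+1 ^ 3 <= h.+1 ^ 2 * nu)%N.
  by rewrite expnSr leq_mul2l; lia.
move: (2 ^ l.+1)%N lel fft nu2 h2 h3 => L lel fft.
rewrite !expnS !expn0 => nu2 h2 h3.
nia.
Qed.

End LevinProgram.

(** The difference of two solutions solves the homogeneous equations. *)
Lemma unique_collocation (R : realType) nu (g : {poly R[i]}) (omega : R)
    (f : R -> R[i]) (alpha : nat -> R[i]) :
  unisolvent nu g omega ->
  (forall m, (m < nu.+2)%N -> (levin_op g omega
    (\sum_(k < nu.+2) alpha k *: chebT R[i] k)).[(cc_point R nu m)%:C] =
    f (cc_point R nu m)) ->
  unique (levin_collocation g omega f) (\col_(k < nu.+2) alpha k).
Proof.
move=> uni alphaE; split=> [m c|beta betaE].
  rewrite -(alphaE m (ltn_ord m)) levin_op_node.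
  by apply: eq_bigr => k _; rewrite mxE.
apply/colP => k; rewrite mxE; apply/eqP; rewrite -subr_eq0; apply/eqP.
pose a k := alpha k - beta (inord k) 0.
rewrite -[k in beta k]inord_val; apply: (uni a) (ltn_ord k) => m ltm.
rewrite levin_op_node; under eq_bigr => j _ do rewrite mulrBl.
rewrite sumrB -levin_op_node alphaE // -(betaE (Ordinal ltm)) /=.
apply/eqP; rewrite subr_eq0; apply/eqP.
by apply: eq_bigr => j _; rewrite inord_val.
Qed.

(** Length 4 (nu + 1) accommodates the Hankel matrix of order 2 (nu + 1), and
    the next power of two is less than 8 (nu + 1), which is at most 12 nu. *)
Lemma fft_size nu : (2 <= nu)%N ->
  exists l, (4 * nu.+1 <= 2 ^ l.+1)%N /\ (2 ^ l.+1 <= 12 * nu)%N.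
Proof.
move=> nu2; pose k := up_log 2 (4 * nu.+1).
have /andP[lo hi] : (2 ^ k.-1 < 4 * nu.+1 <= 2 ^ k)%N.
  by apply: up_log_bounds; lia.
have k0 : (0 < k)%N.
  by move: hi; case: k {lo} => //; rewrite expn0; lia.
exists k.-1; rewrite prednK //; split=> //.
by rewrite -(prednK k0) expnS; lia.
Qed.

(** 12 nu <= 2 ^ 4 * nu <= nu ^ 5, as nu is at least 2. *)
Lemma fft_depth (R : realType) nu l : (2 <= nu)%N -> (2 ^ l.+1 <= 12 * nu)%N ->
  l.+1%:R * ln 2 <= 5 * ln nu%:R :> R.
Proof.
move=> nu2 lel; rewrite !mulr_natl -!lnXn ?ltr0n //; last by lia.
rewrite ler_ln ?posrE ?exprn_gt0 ?ltr0n //; last by lia.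
rewrite -!natrX ler_nat; apply: leq_trans lel _.
have : (2 ^ 4 * nu <= nu ^ 4 * nu)%N by rewrite leq_mul2r leq_exp2r ?nu2 ?orbT.
by rewrite -expnSr; apply: leq_trans; rewrite leq_mul2r orbT.
Qed.

Theorem mainTheorem1 (R : realType) :
  exists K : R, forall d nu : nat,
    (0 < nu)%N -> ~~ odd nu -> (d.+1 <= nu)%N ->
    exists t : comp_tree R,
      (operations t)%:R <= K * (nu%:R * ln nu%:R + d%:R ^+ 2 * nu%:R) /\
      (exponentials t <= 2)%N /\
      forall g : {poly R[i]},
        size g = d.+1 ->
        (forall x : R, -1 <= x <= 1 -> g^`().[x%:C] != 0) ->
        exists omega0 : R, forall (f : R -> R[i]) (omega : R),
          omega0 <= omega ->
          exists alpha : 'cV[R[i]]_nu.+2,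
            unique (levin_collocation g omega f) alpha /\
            run t (levin_input nu g omega f) = Some (levin_value g omega alpha).
Proof.
have ln2 : 0 < ln 2 :> R by rewrite ln_gt0 // ltr1n.
(* 480 = 96 * 5, from program_cost_bound and fft_depth. *)
pose K : R := 480 / ln 2 + 500.
have c0 : 0 <= 480 / ln 2 :> R by rewrite mulr_ge0 ?ler0n ?invr_ge0 ?(ltW ln2).
have K0 : 0 <= K by rewrite addr_ge0 ?c0 ?ler0n.
exists K => d nu nu0 nu_even le_d.
have nu2 : (2 <= nu)%N by case: nu nu0 nu_even {le_d} => [|[|]].
have ln_nu : 0 <= ln nu%:R :> R by rewrite ln_ge0 // ler1n.
case: d le_d => [|h] le_h.
  (* A constant g has g' = 0, so that no input is to be treated. *)
  exists (Return R 0); split=> [|]; last split=> //.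
    by rewrite mulr_ge0 // addr_ge0 // mulr_ge0.
  move=> g sg /(_ 0); rewrite lerN10 ler01 => /(_ isT).
  have /size_poly1P[c _ ->] : size g == 1%N by rewrite sg.
  by rewrite derivC horner0 eqxx.
have [l [lel lel']] := fft_size nu2.
have [t [tc te [alpha alphaP]]] := @levin_program R h nu l lel.
exists t; split; last split=> //.
  have : (operations t <= 96 * (l.+1 * nu) + 500 * (h.+1 ^ 2 * nu))%N.
    exact: leq_trans tc (program_cost_bound le_h lel').
  rewrite -(ler_nat R) natrD !natrM -expr2 => /le_trans; apply.
  have depth := fft_depth R nu2 lel'.
  have depth' : l.+1%:R <= 5 / ln 2 * ln nu%:R :> R.
    by rewrite mulrAC ler_pdivlMr.
  have n0 : 0 <= nu%:R :> R by [].
  have hd : 0 <= h.+1%:R ^+ 2 * nu%:R :> R by rewrite mulr_ge0 ?exprn_ge0.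
  have A : 96 * (l.+1%:R * nu%:R) <= 480 / ln 2 * (nu%:R * ln nu%:R) :> R.
    have := ler_wpM2r n0 depth'; lra.
  have B : 0 <= 480 / ln 2 * (h.+1%:R ^+ 2 * nu%:R) :> R.
    by rewrite mulr_ge0 ?c0 ?hd.
  have D : 0 <= nu%:R * ln nu%:R :> R by rewrite mulr_ge0.
  rewrite /K mulrDl !mulrDr; lra.
move=> g sg g'0.
have [|omega0 uni] := @unisolvent_eventually R nu g.
  by move=> m _; apply: g'0; rewrite /cc_point cos_geN1 cos_le1.
exists omega0 => f omega /uni[w0 uniw].
have [|alphaE runE] := alphaP (g, omega, f); first by split.
exists (\col_(k < nu.+2) alpha k (g, omega, f)); split=> //.
exact: (@unique_collocation _ _ _ _ _ (alpha^~ (g, omega, f))).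
Qed.
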